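(* Let $R$ be a commutative Noetherian ring, $N$ a non-zero finitely generated locally unmixed $R$-module, and $J$ an ideal of $R$ with $N/JN\neq 0$ that can be generated by $\operatorname{height}_N J$ elements. Then the $I$-symbolic topology on $N$ is equivalent to the $I$-adic topology on $N$, where $I=\operatorname{Rad}(J+\operatorname{Ann}_R N)$.
   Context: For an $R$-module $L$, $\operatorname{mAss}_R L$ denotes the set of minimal elements (with respect to inclusion) of $\operatorname{Ass}_R L$. For an ideal $I$ of $R$ and a natural number $n$, the $n$th symbolic power of $I$ with respect to $N$ is $$(IN)^{(n)}=\{x\in N : sx\in I^nN \text{ for some } s\in R\setminus\textstyle\bigcup_{\mathfrak{p}\in \operatorname{mAss}_R N/IN}\mathfrak{p}\},$$ equivalently the intersection of those primary components of $I^nN$ which correspond to the minimal primes of $\operatorname{Ass}_R N/IN$. The $I$-adic topology on $N$ is induced by the filtration $\{I^nN\}_{n\ge 0}$ and the $I$-symbolic topology on $N$ by the filtration $\{(IN)^{(n)}\}_{n\ge 0}$. One always has $I^nN\subseteq (IN)^{(n)}$; the two topologies are said to be equivalent if for every natural number $n$ there is a natural number $m$ such that $(IN)^{(m)}\subseteq I^nN$. Over a local ring $(A,\mathfrak{m})$ with $\mathfrak{m}$-adic completion $A^*$, a finitely generated module $M$ with completion $M^*$ is unmixed if all the prime ideals $z\in\operatorname{Ass}_{A^*}M^*$ have the same dimension $\dim A^*/z$. $N$ is locally unmixed if for every $\mathfrak{p}\in\operatorname{Supp}(N)$ the $R_{\mathfrak{p}}$-module $N_{\mathfrak{p}}$ is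 unmixed. For $\mathfrak{p}\in\operatorname{Supp}(N)$, $\operatorname{height}_N\mathfrak{p}$ is the supremum of lengths of chains of prime ideals of $\operatorname{Supp}(N)$ terminating with $\mathfrak{p}$; for an ideal $J$ with $N/JN\ne0$, $\operatorname{height}_N J=\inf\{\operatorname{height}_N\mathfrak{p}:\mathfrak{p}\in\operatorname{Supp}(N)\cap V(J)\}$. $\operatorname{Rad}$ denotes the radical of an ideal. *)

(* Defs.v *)
From HB Require Import structures.
From mathcomp Require Import all_boot all_order all_algebra.
From mathcomp Require Import boolp classical_sets.
From mathcomp Require Import constructive_ereal.
From mathcomp Require Import ring.

Set Implicit Arguments.
Unset Strict Implicit.
Unset Printing Implicit Defensive.

Import Order.TTheory GRing.Theory Num.Theory.

Local Open Scope classical_set_scope.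
Local Open Scope ring_scope.
Local Open Scope quotient_scope.

Definition is_submod (R : comPzRingType) (M : lmodType R) (W : set M) : Prop :=
  [/\ W 0, forall x y, W x -> W y -> W (x + y)
         & forall (a : R) x, W x -> W (a *: x)].

Record submod (R : comPzRingType) (M : lmodType R) := Submod {
  submod_set :> M -> Prop;
  submodP : is_submod submod_set }.

Arguments submod_set : simpl never.

Notation ideal R := (submod R^o).

Section SubmodTheory.
Variables (R : comPzRingType) (M : lmodType R) (W : submod M).

Lemma submod0 : W 0. Proof. by case: (submodP W). Qed.
Lemma submodD x y : W x -> W y -> W (x + y).
Proof. by case: (submodP W) => _ + _; apply. Qed.
Lemma submodZ (a : R) x : W x -> W (a *: x).
Proof. by case: (submodP W) => _ _; apply. Qed.
Lemma submodN x : W x -> W (- x).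
Proof. by rewrite -scaleN1r; exact: submodZ. Qed.
Lemma submodB x y : W x -> W y -> W (x - y).
Proof. by move=> Wx Wy; apply/submodD/submodN. Qed.

End SubmodTheory.

Section SubmodOps.
Variables (R : comPzRingType) (M : lmodType R).
Implicit Types (A : set M) (W : submod M).

Fact full_subproof : @is_submod R M setT.
Proof. by []. Qed.
Definition fullmod : submod M := Submod full_subproof.

Fact gen_subproof A : is_submod (smallest (@is_submod R M) A).
Proof.
split=> [B [[]]//|x y Ax Ay B /= hB|a x Ax B /= hB].
- case: (hB) => -[_ BD _] _; apply: BD; [exact: Ax|exact: Ay].
- case: (hB) => -[_ _ BZ] _; apply: BZ; exact: Ax.
Qed.
Definition genmod A : submod M := Submod (gen_subproof A).

Definition mulmod (I : ideal R) W : submod M :=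
  genmod [set x | exists a y, [/\ I a, W y & x = a *: y]].

Fact ann_subproof : @is_submod R R^o [set a | forall x : M, a *: x = 0].
Proof.
split=> [x|a b ha hb x|a b hb x] /=; first by rewrite scale0r.
- by rewrite scalerDl ha hb addr0.
- by rewrite -[a *: b]/(a * b) -scalerA hb scaler0.
Qed.
Definition Ann : ideal R := Submod ann_subproof.

Definition fin_gen : Prop :=
  exists s : seq M, (genmod [set` s] : set M) = setT.

End SubmodOps.
Arguments fullmod {R} M.
Arguments Ann {R} M.
Arguments fin_gen {R} M.

Section Ideals.
Variable R : comPzRingType.
Implicit Types I J K : ideal R.

Definition ideal_exp I (n : nat) : ideal R :=
  iter n (@mulmod R R^o I) (fullmod R^o).

Fact sum_subproof I J :
  @is_submod R R^o [set a | exists b c, [/\ I b, J c & a = b + c]].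
Proof.
split=> [|x y|a x] /=.
- by exists 0, 0; rewrite addr0; split=> //; exact: submod0.
- move=> [b [c [Ib Jc ->]]] [b' [c' [Ib' Jc' ->]]].
  by exists (b + b'), (c + c'); rewrite addrACA; split=> //; exact: submodD.
- move=> [b [c [Ib Jc ->]]].
  exists (a *: b), (a *: c); rewrite -scalerDr; split=> //.
  + exact: (@submodZ R R^o I a b Ib).
  + exact: (@submodZ R R^o J a c Jc).
Qed.
Definition ideal_sum I J : ideal R := Submod (sum_subproof I J).

Fact rad_subproof I : @is_submod R R^o [set a : R | exists n, I (a ^+ n)].
Proof.
split=> [|x y [m Im] [n In]|a x [n In]] /=.
- by exists 1%N; rewrite expr1; exact: submod0.
- exists (m + n)%N; rewrite exprDn.
  apply: (big_ind (fun z => I z)) => [||i _]; first exact: submod0.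
    exact: submodD.
  rewrite -mulr_natr mulrC -[_ * _]/(_ *: (_ : R^o)); apply: submodZ.
  have [le_ni|lt_in] := leqP n i.
  + rewrite -(subnK le_ni) exprD mulrA.
    by rewrite -[_ * _]/(_ *: (_ : R^o)); apply: submodZ.
  + have le_m : (m <= m + n - i)%N by rewrite -addnBA ?leq_addr // ltnW.
    rewrite -(subnK le_m) exprD mulrC mulrA.
    by rewrite -[_ * _]/(_ *: (_ : R^o)); apply: submodZ.
- exists n; rewrite -[a *: x]/(a * x) exprMn.
  exact: (@submodZ R R^o I).
Qed.
Definition Rad I : ideal R := Submod (rad_subproof I).

Definition is_prime (P : ideal R) : Prop :=
  ~ P 1 /\ forall a b : R, P (a * b) -> P a \/ P b.

Record spec := Spec { spec_ideal :> ideal R; specP : is_prime spec_ideal }.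

Definition noetherian : Prop :=
  forall I, exists s : seq R, (I : set R) = @genmod R R^o [set` s].

End Ideals.
Arguments noetherian R : clear implicits.

Section QuotMod.
Variables (R : comPzRingType) (M : lmodType R) (W : submod M).

Definition submod_pred : {pred M} := fun x => `[< W x >].

Fact submod_pred_closed : zmod_closed submod_pred.
Proof.
split; first exact/asboolP/submod0.
by move=> x y /asboolP Wx /asboolP Wy; apply/asboolP; exact: submodB.
Qed.
HB.instance Definition _ := GRing.isZmodClosed.Build M submod_pred
  submod_pred_closed.

Definition quotmod : Type := Quotient.quot submod_pred.
HB.instance Definition _ := GRing.Zmodule.on quotmod.
HB.instance Definition _ := EqQuotient.on quotmod.

Definition qcls (x : M) : quotmod := \pi_quotmod x.

Lemma qcls_eqP x y : qcls x = qcls y <-> W (x - y).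
Proof.
split.
- by move/eqP; rewrite -Quotient.idealrBE => /asboolP.
- by move=> h; apply/eqP; rewrite -Quotient.idealrBE; apply/asboolP.
Qed.

Lemma qcls_repr (u : quotmod) : qcls (repr u) = u.
Proof. exact: reprK. Qed.

Lemma qclsD x y : qcls (x + y) = qcls x + qcls y.
Proof. by rewrite /qcls !piE. Qed.

Definition qscale (a : R) (u : quotmod) : quotmod := qcls (a *: repr u).

Lemma qscaleE a x : qscale a (qcls x) = qcls (a *: x).
Proof.
by apply/qcls_eqP; rewrite -scalerBr; apply/submodZ/qcls_eqP/qcls_repr.
Qed.

Fact qscaleA a b u : qscale a (qscale b u) = qscale (a * b) u.
Proof. by rewrite -(qcls_repr u) !qscaleE scalerA. Qed.
Fact qscale1 : left_id 1 qscale.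
Proof. by move=> u; rewrite -(qcls_repr u) qscaleE scale1r. Qed.
Fact qscaleDr : right_distributive qscale +%R.
Proof.
move=> a u v; rewrite -(qcls_repr u) -(qcls_repr v).
by rewrite -qclsD !qscaleE scalerDr qclsD.
Qed.
Fact qscaleDl u : {morph qscale^~ u : a b / a + b}.
Proof. by move=> a b; rewrite -(qcls_repr u) !qscaleE scalerDl qclsD. Qed.
HB.instance Definition _ := GRing.Zmodule_isLmodule.Build R quotmod
  qscaleA qscale1 qscaleDr qscaleDl.

Lemma qclsZ a x : qcls (a *: x) = a *: qcls x.
Proof. by rewrite -qscaleE. Qed.

End QuotMod.
Arguments qcls {R M} W x.

Section QuotRing.
Variables (R : comPzRingType) (I : ideal R).

Definition quotring : Type := @quotmod R R^o I.
HB.instance Definition _ := GRing.Zmodule.on quotring.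

Definition qrcls (a : R) : quotring := @qcls R R^o I a.
Definition qrmul (u v : quotring) : quotring := qrcls (repr u * repr v).

Lemma qrmulE a b : qrmul (qrcls a) (qrcls b) = qrcls (a * b).
Proof.
have /qcls_eqP ha := qcls_repr (qrcls a).
have /qcls_eqP hb := qcls_repr (qrcls b).
apply/qcls_eqP; set a' := repr (qrcls a) in ha *; set b' := repr (qrcls b) in hb *.
have -> : a' * b' - a * b = b' * (a' - a) + a * (b' - b).
  by rewrite !mulrBr addrA mulrC [b' * a]mulrC subrK.
by apply: submodD; rewrite -[_ * _]/(_ *: (_ : R^o)); exact: submodZ.
Qed.
Lemma qrcls_repr (u : quotring) : qrcls (repr u) = u.
Proof. exact: qcls_repr. Qed.
Lemma qrclsD a b : qrcls (a + b) = qrcls a + qrcls b.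
Proof. exact: (@qclsD R R^o I). Qed.

Fact qrmulA : associative qrmul.
Proof.
move=> u v w; rewrite -(qrcls_repr u) -(qrcls_repr v) -(qrcls_repr w).
by rewrite !qrmulE mulrA.
Qed.
Fact qrmulC : commutative qrmul.
Proof.
by move=> u v; rewrite -(qrcls_repr u) -(qrcls_repr v) !qrmulE mulrC.
Qed.
Fact qrmul1 : left_id (qrcls 1) qrmul.
Proof. by move=> u; rewrite -(qrcls_repr u) qrmulE mul1r. Qed.
Fact qrmulDl : left_distributive qrmul +%R.
Proof.
move=> u v w; rewrite -(qrcls_repr u) -(qrcls_repr v) -(qrcls_repr w).
by rewrite -qrclsD !qrmulE mulrDl qrclsD.
Qed.
HB.instance Definition _ := GRing.Zmodule_isComPzRing.Build quotring
  qrmulA qrmulC qrmul1 qrmulDl.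

End QuotRing.

Section Localization.
Variables (R : comPzRingType) (p : spec R).

Record denom := Denom { den : R; denomP : ~ p den }.

HB.instance Definition _ := gen_eqMixin denom.
HB.instance Definition _ := gen_choiceMixin denom.

Fact denom1_subproof : ~ p 1. Proof. by case: (specP p). Qed.
Definition denom1 := Denom denom1_subproof.

Fact denomM_subproof (s t : denom) : ~ p (den s * den t).
Proof. by case: (specP p) => _ h /h[]; exact: denomP. Qed.
Definition denomM s t := Denom (@denomM_subproof s t).

Section LocMod.
Variable M : lmodType R.

Lemma scale_chain (x y : M) (c d d' e e' : R) :
  d *: x = d' *: y -> e = c * d -> e' = c * d' -> e *: x = e' *: y.
Proof. by move=> h -> ->; rewrite -!scalerA h. Qed.

(* The pair (x, s) stands for the fraction x/s. *)
Definition loc_rel (u v : M * denom) : bool :=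
  `[< exists t : denom,
        (den t * den v.2) *: u.1 = (den t * den u.2) *: v.1 >].

Fact loc_rel_equiv : equiv_class_of loc_rel.
Proof.
split=> [u|u v|v u w].
- by apply/asboolP; exists denom1.
- by apply/asboolP/asboolP => -[t h]; exists t.
- move=> /asboolP[a ha] /asboolP[b hb]; apply/asboolP.
  exists (denomM (denomM a b) v.2) => /=.
  transitivity ((den a * den u.2 * (den b * den w.2)) *: v.1).
    by apply: (scale_chain (c := den b * den w.2) ha); ring.
  by apply: (scale_chain (c := den a * den u.2) hb); ring.
Qed.
Canonical loc_equiv := EquivRelPack loc_rel_equiv.
Canonical loc_encModRel := defaultEncModRel loc_rel.

Definition loc : Type := {eq_quot loc_rel}.
HB.instance Definition _ := Choice.on loc.
HB.instance Definition _ := EqQuotient.on loc.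

Definition frac (x : M) (s : denom) : loc := \pi_loc (x, s).

Lemma frac_eqP x s y t : frac x s = frac y t <->
  exists c : denom, (den c * den t) *: x = (den c * den s) *: y.
Proof.
split; first by move/eqP; rewrite piE => /asboolP.
by move=> h; apply/eqP; rewrite piE; apply/asboolP.
Qed.

Lemma frac_repr (u : loc) : frac (repr u).1 (repr u).2 = u.
Proof. by rewrite /frac -surjective_pairing reprK. Qed.

Lemma fracP (u : loc) : exists x s, u = frac x s.
Proof. by exists (repr u).1, (repr u).2; rewrite frac_repr. Qed.

Definition loc_zero : loc := frac 0 denom1.
Definition loc_opp (u : loc) : loc := frac (- (repr u).1) (repr u).2.
Definition loc_add (u v : loc) : loc :=
  let: (x, s) := repr u in let: (y, t) := repr v in
  frac (den t *: x + den s *: y) (denomM s t).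

Lemma loc_oppE x s : loc_opp (frac x s) = frac (- x) s.
Proof.
have /frac_eqP[c h] := frac_repr (frac x s); apply/frac_eqP; exists c.
by rewrite !scalerN h.
Qed.

Lemma loc_addE x s y t : loc_add (frac x s) (frac y t) =
  frac (den t *: x + den s *: y) (denomM s t).
Proof.
have := frac_repr (frac x s); have := frac_repr (frac y t); rewrite /loc_add.
case: (repr (frac x s)) => x' s'; case: (repr (frac y t)) => y' t' /=.
move=> /frac_eqP[b hb] /frac_eqP[a ha]; apply/frac_eqP.
exists (denomM a b) => /=; rewrite !scalerDr !scalerA; congr (_ + _).
- by apply: (scale_chain (c := den b * den t * den t') ha); ring.
- by apply: (scale_chain (c := den a * den s * den s') hb); ring.
Qed.

Lemma frac_scale x s (c : denom) : frac (den c *: x) (denomM c s) = frac x s.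
Proof.
by apply/frac_eqP; exists denom1; rewrite scalerA /=; congr (_ *: _); ring.
Qed.

Lemma denom_eq (s t : denom) : den s = den t -> s = t.
Proof.
by case: s t => [s hs] [t ht] /= e; subst t; rewrite (Prop_irrelevance hs ht).
Qed.

Fact loc_addA : associative loc_add.
Proof.
move=> u v w; have [x [s ->]] := fracP u; have [y [t ->]] := fracP v.
have [z [r ->]] := fracP w; rewrite !loc_addE; congr frac.
  rewrite !scalerDr !scalerA addrA.
  by congr (_ *: _ + _ *: _ + _ *: _) => /=; ring.
by apply: denom_eq => /=; ring.
Qed.
Fact loc_addC : commutative loc_add.
Proof.
move=> u v; have [x [s ->]] := fracP u; have [y [t ->]] := fracP v.
rewrite !loc_addE addrC; congr frac.
by apply: denom_eq => /=; ring.
Qed.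
Fact loc_add0 : left_id loc_zero loc_add.
Proof.
move=> u; have [x [s ->]] := fracP u; rewrite loc_addE scaler0 add0r.
exact: frac_scale.
Qed.
Fact loc_addN : left_inverse loc_zero loc_opp loc_add.
Proof.
move=> u; have [x [s ->]] := fracP u; rewrite loc_oppE loc_addE scalerN addNr.
by apply/frac_eqP; exists denom1; rewrite !scaler0.
Qed.
HB.instance Definition _ :=
  GRing.isZmodule.Build loc loc_addA loc_addC loc_add0 loc_addN.

Lemma fracD x s y t : frac x s + frac y t =
  frac (den t *: x + den s *: y) (denomM s t).
Proof. exact: loc_addE. Qed.

End LocMod.

Definition locring : Type := loc R^o.
HB.instance Definition _ := GRing.Zmodule.on locring.
Definition rfrac (a : R) (s : denom) : locring := @frac R^o a s.

Section LocScale.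
Variable M : lmodType R.

Definition loc_scale (u : locring) (v : loc M) : loc M :=
  frac ((repr u).1 *: (repr v).1) (denomM (repr u).2 (repr v).2).

Lemma loc_scaleE a s (x : M) t :
  loc_scale (rfrac a s) (frac x t) = frac (a *: x) (denomM s t).
Proof.
have := @frac_repr R^o (rfrac a s); have := frac_repr (frac x t).
rewrite /loc_scale; case: (repr (rfrac a s)) => a' s'.
case: (repr (frac x t)) => x' t' /= /frac_eqP[c hc] /frac_eqP[b hb].
have {}hb : den b * den s * a' = den b * den s' * a by [].
apply/frac_eqP; exists (denomM b c); rewrite !scalerA /=.
apply: (scale_chain (c := den b * den s * a') hc); first by ring.
by rewrite hb; ring.
Qed.

End LocScale.

Lemma rfracP (u : locring) : exists a s, u = rfrac a s.
Proof. exact: (@fracP R^o u). Qed.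

Definition loc_mul : locring -> locring -> locring := @loc_scale R^o.
Lemma loc_mulE a s b t :
  loc_mul (rfrac a s) (rfrac b t) = rfrac (a * b) (denomM s t).
Proof. exact: (@loc_scaleE R^o). Qed.
Lemma rfracD a s b t :
  rfrac a s + rfrac b t = rfrac (den t * a + den s * b) (denomM s t).
Proof. exact: (@fracD R^o). Qed.
Lemma rfrac_eqP a s b t : rfrac a s = rfrac b t <->
  exists c : denom, den c * den t * a = den c * den s * b.
Proof. exact: (@frac_eqP R^o). Qed.

Fact loc_mulA : associative loc_mul.
Proof.
move=> u v w; have [x [s ->]] := rfracP u; have [y [t ->]] := rfracP v.
have [z [r ->]] := rfracP w; rewrite !loc_mulE mulrA; congr rfrac.
by apply: denom_eq => /=; ring.
Qed.
Fact loc_mulC : commutative loc_mul.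
Proof.
move=> u v; have [x [s ->]] := rfracP u; have [y [t ->]] := rfracP v.
by rewrite !loc_mulE mulrC; congr rfrac; apply: denom_eq => /=; ring.
Qed.
Fact loc_mul1 : left_id (rfrac 1 denom1) loc_mul.
Proof.
move=> u; have [x [s ->]] := rfracP u.
by rewrite loc_mulE mul1r; congr rfrac; apply: denom_eq => /=; ring.
Qed.
Fact loc_mulDl : left_distributive loc_mul +%R.
Proof.
move=> u v w; have [x [s ->]] := rfracP u; have [y [t ->]] := rfracP v.
have [z [r ->]] := rfracP w; rewrite rfracD !loc_mulE rfracD.
by apply/rfrac_eqP; exists denom1 => /=; ring.
Qed.
HB.instance Definition _ := GRing.Zmodule_isComPzRing.Build locring
  loc_mulA loc_mulC loc_mul1 loc_mulDl.

Lemma rfracM a s b t : rfrac a s * rfrac b t = rfrac (a * b) (denomM s t).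
Proof. exact: loc_mulE. Qed.

Section LocLmod.
Variable M : lmodType R.

Fact loc_scaleA (a b : locring) (u : loc M) :
  loc_scale a (loc_scale b u) = loc_scale (a * b) u.
Proof.
have [x [s ->]] := rfracP a; have [y [t ->]] := rfracP b.
have [z [r ->]] := fracP u; rewrite rfracM !loc_scaleE scalerA; congr frac.
by apply: denom_eq => /=; ring.
Qed.
Fact loc_scale1 : left_id 1 (@loc_scale M).
Proof.
move=> u; have [z [r ->]] := fracP u; rewrite [1]/(rfrac 1 denom1).
by rewrite loc_scaleE scale1r; congr frac; apply: denom_eq => /=; ring.
Qed.
Fact loc_scaleDr : right_distributive (@loc_scale M) +%R.
Proof.
move=> a u v; have [x [s ->]] := rfracP a; have [y [t ->]] := fracP u.
have [z [r ->]] := fracP v; rewrite fracD !loc_scaleE fracD.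
apply/frac_eqP; exists denom1; rewrite !scalerDr !scalerA /=.
by congr (_ *: _ + _ *: _); ring.
Qed.
Fact loc_scaleDl (u : loc M) : {morph (@loc_scale M)^~ u : a b / a + b}.
Proof.
move=> a b; have [x [s ->]] := rfracP a; have [y [t ->]] := rfracP b.
have [z [r ->]] := fracP u; rewrite rfracD !loc_scaleE fracD.
apply/frac_eqP; exists denom1; rewrite !scalerDr !scalerA /= -scalerDl.
by congr (_ *: _); ring.
Qed.
HB.instance Definition _ := GRing.Zmodule_isLmodule.Build locring (loc M)
  loc_scaleA loc_scale1 loc_scaleDr loc_scaleDl.

End LocLmod.

(* The maximal ideal p R_p *)
Fact locmax_subproof :
  @is_submod locring locring^o [set u | exists a s, p a /\ u = rfrac a s].
Proof.
split=> [|u v|u v] /=.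
- by exists 0, denom1; split=> //; exact: submod0.
- move=> [a [s [pa ->]]] [b [t [pb ->]]].
  exists (den t * a + den s * b), (denomM s t).
  split; last exact: rfracD.
  by apply: submodD; rewrite -[_ * _]/(_ *: (_ : R^o)); exact: submodZ.
- move=> [a [s [pa ->]]]; have [b [t ->]] := rfracP u.
  exists (b * a), (denomM t s); split; last exact: loc_mulE.
  by rewrite -[_ * _]/(_ *: (_ : R^o)); exact: submodZ.
Qed.
Definition locmax : ideal locring := Submod locmax_subproof.

End Localization.

Definition adic (R : comPzRingType) (I : ideal R) (M : lmodType R) (n : nat) :
  submod M := mulmod (ideal_exp I n) (fullmod M).

Section Completion.
Variables (R : comPzRingType) (I : ideal R).

Lemma gen_min (M : lmodType R) (A : set M) (B : set M) :
  is_submod B -> (forall x, A x -> B x) -> forall x, genmod A x -> B x.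
Proof. by move=> sB sAB x; apply; split. Qed.

Lemma sub_gen (M : lmodType R) (A : set M) x : A x -> genmod A x.
Proof. by move=> Ax B [_]; apply. Qed.

Lemma ideal_expS n a : ideal_exp I n.+1 a -> ideal_exp I n a.
Proof.
apply: gen_min; first exact: submodP.
by move=> _ [b [c [_ Jc ->]]]; exact: (@submodZ R R^o).
Qed.

Lemma adicS (M : lmodType R) n x : adic I M n.+1 x -> adic I M n x.
Proof.
apply: gen_min; first exact: submodP.
move=> _ [a [y [/ideal_expS Ja _ ->]]].
by apply: sub_gen; exists a, y; split.
Qed.

Lemma adic_scale (M : lmodType R) n a (x : M) :
  adic I R^o n a -> adic I M n (a *: x).
Proof.
move: a; apply: (@gen_min R^o _ [set a : R | adic I M n (a *: x)]).
  split=> [|a b ha hb|a b hb] /=; first by rewrite scale0r; exact: submod0.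
    by rewrite scalerDl; exact: submodD.
  by rewrite -[a *: b]/(a * b) -scalerA; exact: submodZ.
move=> _ [a [b [Ja _ ->]]] /=.
by rewrite -[a *: b]/(a * b) -scalerA; apply: sub_gen; exists a, (b *: x).
Qed.

(* The inverse limit of the M / I^n M: compatible families of classes. *)
Record compl (M : lmodType R) := Compl {
  cfam :> forall n, quotmod (adic I M n);
  cfamP : forall n, qcls (adic I M n) (repr (cfam n.+1)) = cfam n }.

Section ComplMod.
Variable M : lmodType R.

HB.instance Definition _ := gen_eqMixin (compl M).
HB.instance Definition _ := gen_choiceMixin (compl M).

Lemma compl_eq (u v : compl M) : (forall n, u n = v n) -> u = v.
Proof.
case: u v => [u hu] [v hv] /= e.
have {}e : u = v by apply: functional_extensionality_dep.
by subst v; rewrite (Prop_irrelevance hu hv).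
Qed.

Lemma qcls_adicS n (x y : M) :
  qcls (adic I M n.+1) x = qcls (adic I M n.+1) y ->
  qcls (adic I M n) x = qcls (adic I M n) y.
Proof. by move/qcls_eqP/adicS => h; apply/qcls_eqP. Qed.

(* A family is determined by representatives x_n, compatible when
   x_n.+1 = x_n modulo I^n M. *)
Fact mk_compl_subproof (x : nat -> M) :
  (forall n, qcls (adic I M n) (x n.+1) = qcls (adic I M n) (x n)) ->
  forall n, qcls (adic I M n) (repr (qcls (adic I M n.+1) (x n.+1)))
          = qcls (adic I M n) (x n).
Proof. by move=> h n; rewrite -(h n); apply: qcls_adicS; exact: qcls_repr. Qed.
Definition mk_compl x h : compl M := Compl (@mk_compl_subproof x h).

Lemma cfam_repr (u : compl M) n :
  qcls (adic I M n) (repr (u n.+1)) = qcls (adic I M n) (repr (u n)).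
Proof. by rewrite cfamP qcls_repr. Qed.

Fact compl0_subproof n : qcls (adic I M n) 0 = qcls (adic I M n) 0.
Proof. by []. Qed.
Definition compl0 : compl M := mk_compl compl0_subproof.

Fact complN_subproof (u : compl M) n :
  qcls (adic I M n) (- repr (u n.+1)) = qcls (adic I M n) (- repr (u n)).
Proof.
apply/qcls_eqP; rewrite -opprD; apply: submodN.
by have /qcls_eqP := cfam_repr u n.
Qed.
Definition complN u : compl M := mk_compl (complN_subproof u).

Fact complD_subproof (u v : compl M) n :
  qcls (adic I M n) (repr (u n.+1) + repr (v n.+1))
  = qcls (adic I M n) (repr (u n) + repr (v n)).
Proof. by rewrite !qclsD !cfam_repr. Qed.
Definition complD u v : compl M := mk_compl (complD_subproof u v).

Lemma complDE u v n : complD u v n = u n + v n.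
Proof. by rewrite /= qclsD !qcls_repr. Qed.

Fact complDA : associative complD.
Proof. by move=> u v w; apply: compl_eq => n; rewrite !complDE addrA. Qed.
Fact complDC : commutative complD.
Proof. by move=> u v; apply: compl_eq => n; rewrite !complDE addrC. Qed.
Lemma qcls0 n : qcls (adic I M n) 0 = 0.
Proof. by rewrite /qcls !piE. Qed.
Fact complD0 : left_id compl0 complD.
Proof.
by move=> u; apply: compl_eq => n; rewrite complDE /= qcls0 add0r.
Qed.
Fact complDN : left_inverse compl0 complN complD.
Proof.
move=> u; apply: compl_eq => n; rewrite complDE /=.
by rewrite -[X in _ + X]qcls_repr -qclsD addNr.
Qed.
HB.instance Definition _ :=
  GRing.isZmodule.Build (compl M) complDA complDC complD0 complDN.

End ComplMod.

Definition complring : Type := compl R^o.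
HB.instance Definition _ := GRing.Zmodule.on complring.

Section ComplScale.
Variable M : lmodType R.

Lemma qcls_scale n (a b : R) (x y : M) :
  @qcls R R^o (adic I R^o n) a = @qcls R R^o (adic I R^o n) b ->
  qcls (adic I M n) x = qcls (adic I M n) y ->
  qcls (adic I M n) (a *: x) = qcls (adic I M n) (b *: y).
Proof.
move=> /qcls_eqP hab /qcls_eqP hxy; apply/qcls_eqP.
have -> : a *: x - b *: y = (a - b) *: x + b *: (x - y).
  by rewrite scalerBl scalerBr addrA subrK.
by apply: submodD; [exact: adic_scale|exact: submodZ].
Qed.

Fact compl_scale_subproof (a : complring) (u : compl M) n :
  qcls (adic I M n) ((repr (a n.+1) : R) *: repr (u n.+1))
  = qcls (adic I M n) ((repr (a n) : R) *: repr (u n)).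
Proof. by apply: qcls_scale; exact: cfam_repr. Qed.
Definition compl_scale a u : compl M := mk_compl (compl_scale_subproof a u).

End ComplScale.

Fact compl1_subproof n :
  @qcls R R^o (adic I R^o n) 1 = @qcls R R^o (adic I R^o n) 1.
Proof. by []. Qed.
Definition compl1 : complring := mk_compl compl1_subproof.

Definition compl_mul : complring -> complring -> complring :=
  @compl_scale R^o.

Section ComplScaleTheory.
Variable M : lmodType R.
Implicit Types (a b : complring) (u v : compl M).

Lemma compl_scaleE a u n :
  compl_scale a u n = qcls (adic I M n) ((repr (a n) : R) *: repr (u n)).
Proof. by []. Qed.

Lemma compl_mul_scaleA a b u :
  compl_scale a (compl_scale b u) = compl_scale (compl_mul a b) u.
Proof.
apply: compl_eq => n; rewrite !compl_scaleE.
transitivity (qcls (adic I M n)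
    ((repr (a n) : R) *: ((repr (b n) : R) *: repr (u n)))).
  by apply: qcls_scale => //; exact: qcls_repr.
rewrite scalerA; apply: qcls_scale => //.
by symmetry; exact: (@qcls_repr R R^o).
Qed.

Lemma compl1_scale u : compl_scale compl1 u = u.
Proof.
apply: compl_eq => n; rewrite compl_scaleE -[RHS]qcls_repr -[in RHS](scale1r (repr _)).
by apply: qcls_scale => //; exact: (@qcls_repr R R^o).
Qed.

Lemma compl_scale_addr a u v :
  compl_scale a (u + v) = compl_scale a u + compl_scale a v.
Proof.
apply: compl_eq => n; rewrite [RHS]complDE !compl_scaleE -qclsD -scalerDr.
by apply: qcls_scale => //; exact: qcls_repr.
Qed.

Lemma compl_scale_addl a b u :
  compl_scale (a + b) u = compl_scale a u + compl_scale b u.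
Proof.
apply: compl_eq => n; rewrite [RHS]complDE !compl_scaleE -qclsD -scalerDl.
by apply: qcls_scale => //; exact: (@qcls_repr R R^o).
Qed.

End ComplScaleTheory.

Fact compl_mulA : associative compl_mul.
Proof. by move=> a b c; exact: (@compl_mul_scaleA R^o). Qed.
Fact compl_mulC : commutative compl_mul.
Proof.
move=> a b; apply: compl_eq => n; rewrite !compl_scaleE.
by congr qcls; exact: mulrC.
Qed.
Fact compl_mul1 : left_id compl1 compl_mul.
Proof. exact: (@compl1_scale R^o). Qed.
Fact compl_mulDl : left_distributive compl_mul +%R.
Proof. by move=> a b c; exact: (@compl_scale_addl R^o). Qed.
HB.instance Definition _ := GRing.Zmodule_isComPzRing.Build complring
  compl_mulA compl_mulC compl_mul1 compl_mulDl.

Section ComplLmod.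
Variable M : lmodType R.

Fact compl_scaleA (a b : complring) (u : compl M) :
  compl_scale a (compl_scale b u) = compl_scale (a * b) u.
Proof. exact: compl_mul_scaleA. Qed.
Fact compl_scale1 : left_id (1 : complring) (@compl_scale M).
Proof. exact: compl1_scale. Qed.
Fact compl_scaleDr : right_distributive (@compl_scale M) +%R.
Proof. exact: compl_scale_addr. Qed.
Fact compl_scaleDl (u : compl M) :
  {morph (@compl_scale M)^~ u : a b / a + b}.
Proof. by move=> a b; exact: compl_scale_addl. Qed.
HB.instance Definition _ := GRing.Zmodule_isLmodule.Build complring (compl M)
  compl_scaleA compl_scale1 compl_scaleDr compl_scaleDl.

End ComplLmod.
End Completion.

Section Primes.
Variables (R : comPzRingType) (M : lmodType R).

Definition Ass : set (spec R) :=
  [set p | exists x : M, forall a : R, p a <-> a *: x = 0].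

Definition mAss : set (spec R) :=
  [set p | Ass p /\ forall q, Ass q -> (q : set R) `<=` p -> (q : set R) = p].

Definition Supp : set (spec R) := [set p | exists u : loc p M, u != 0].

End Primes.
Arguments Ass {R} M.
Arguments mAss {R} M.
Arguments Supp {R} M.

Definition Vset (R : comPzRingType) (I : ideal R) : set (spec R) :=
  [set p | (I : set R) `<=` p].

(* c 0 < ... < c n is a chain of length n of primes from P. *)
Definition prime_chain (R : comPzRingType) (P : set (spec R)) (n : nat)
    (c : nat -> spec R) : Prop :=
  (forall i, (i <= n)%N -> P (c i)) /\
  (forall i, (i < n)%N -> (c i : set R) `<` c i.+1).

(* Heights and dimensions are elements of \bar int; they are +oo when the
   lengths of chains are unbounded. *)
Definition sup_length (L : set nat) : \bar int :=
  supremum -oo%E [set (n%:Z)%:E%E | n in L].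

Definition krull_dim (R : comPzRingType) : \bar int :=
  sup_length [set n | exists c, prime_chain (@setT (spec R)) n c].

Definition height_prime (R : comPzRingType) (M : lmodType R) (p : spec R) :
    \bar int :=
  sup_length [set n | exists c, prime_chain (Supp M) n c /\ c n = p].

Definition height_ideal (R : comPzRingType) (M : lmodType R) (J : ideal R) :
    \bar int :=
  infimum +oo%E [set height_prime M p | p in Supp M `&` Vset J].

(* Meant for R local with maximal ideal m. *)
Definition unmixed (R : comPzRingType) (m : ideal R) (M : lmodType R) : Prop :=
  forall z z' : spec (complring m),
    Ass (compl m M) z -> Ass (compl m M) z' ->
    krull_dim (quotring z) = krull_dim (quotring z').

Definition locally_unmixed (R : comPzRingType) (M : lmodType R) : Prop :=
  forall p : spec R, Supp M p -> unmixed (locmax p) (loc p M).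

Definition symb_pow (R : comPzRingType) (I : ideal R) (M : lmodType R)
    (n : nat) : set M :=
  [set x | exists s : R,
     (forall p, mAss (quotmod (mulmod I (fullmod M))) p -> ~ p s) /\
     adic I M n (s *: x)].

Arguments symb_pow {R} I M n _.

Definition symbolic_equiv_adic (R : comPzRingType) (I : ideal R)
    (M : lmodType R) : Prop :=
  forall n, exists m, symb_pow I M m `<=` adic I M n.

(* Main.v *)
(** Write [M = N_p] and [M^*] for its completion. The topologies are compared one
prime [p] at a time, by induction on the length of chains of primes below [p].
If [p] is minimal over [I] there is nothing to prove. Otherwise the induction
hypothesis places [(IN)^(k)], locally at [p], inside [(I^n M : m^oo)]. If these
saturations did not shrink into the powers [I^n M], a Mittag-Leffler argument
would give a nonzero element of [M^*] that powers of [m] send into every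
[I^k M^*]; by Krull's intersection theorem some [z] in [Ass M^*] would then have
[m^*] as the only prime over [I + z]. Since [I] is the radical of an ideal with
[h = height J] generators modulo [Ann N], Krull's height theorem bounds
[dim A^*/z] by [h], unmixedness propagates the bound to all of [Ass M^*], and
[M] gets a system of at most [h] parameters; but [p] strictly contains a prime
of [Supp N] over [J], so [M] has dimension at least [h + 1].

Localizations other than the [N_p] of the hypothesis are replaced by saturations
[sat Q V = {x | s x in V for some s outside Q}]. *)
From HB Require Import structures.
Require Import Defs.
From mathcomp Require Import all_boot all_order all_algebra.
From mathcomp Require Import boolp classical_sets.
From mathcomp Require Import constructive_ereal.
From mathcomp Require Import zify ring.
(* Restores the [frac] of the localization, hidden by that of fraction fields. *)
Import Defs.

Set Implicit Arguments.
Unset Strict Implicit.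
Unset Printing Implicit Defensive.

Import Order.TTheory GRing.Theory Num.Theory.

Local Open Scope classical_set_scope.
Local Open Scope ring_scope.

(** * Submodules and saturations *)

(** The number k that works at a prime p depends on p. What makes it uniform are the ideals (I^n N :
    (IN)^(k)): they increase with k, so they stop growing at some K that serves all primes at once,
    and an ideal contained in no prime contains 1. The same ideals carry the induction: if such an
    ideal lies in no prime strictly below p, it contains a power of p locally at p, and this is
    where the saturation by powers of m comes from.

    The Mittag-Leffler argument works because (I^n M : m^oo) is sent into I^n M by a single power of
    m, so that descending chains between the two stabilize; [dcc_sat] states this without lengths,
    and the principal ideal theorem uses it too. The completion is a bare inverse limit, so that A^*
    is Noetherian has to be proved; the parameters are chosen in A, and their effect on M^* is
    brought back to M by approximation modulo powers of m and Nakayama's lemma. *)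

Section Submodules.
Variable R : comPzRingType.
Implicit Type M : lmodType R.

Lemma ideal_mull (I : ideal R) (a b : R) : I b -> I (a * b).
Proof. exact: (@submodZ R R^o I a b). Qed.

Lemma ideal_mulr (I : ideal R) (a b : R) : I a -> I (a * b).
Proof. by rewrite mulrC; exact: ideal_mull. Qed.

Lemma sum_mem M (W : submod M) n (F : 'I_n -> M) :
  (forall i, W (F i)) -> W (\sum_(i < n) F i).
Proof.
by move=> h; apply: big_ind => //; [exact: submod0|exact: submodD].
Qed.

Lemma primeM (Q : spec R) a b : Q (a * b) -> Q a \/ Q b.
Proof. by case: (specP Q) => _; apply. Qed.

Lemma prime1 (Q : spec R) : ~ Q 1.
Proof. by case: (specP Q). Qed.

Lemma primeNM (Q : spec R) a b : ~ Q a -> ~ Q b -> ~ Q (a * b).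
Proof. by move=> ha hb /primeM[]. Qed.

Lemma primeX (Q : spec R) a n : Q (a ^+ n) -> Q a.
Proof.
elim: n => [|n ih]; first by rewrite expr0 => /prime1.
by rewrite exprS => /primeM[].
Qed.

Lemma genmod_cons M (g : M) s x : genmod [set` g :: s] x ->
  exists a y, genmod [set` s] y /\ x = a *: g + y.
Proof.
apply: (@gen_min R M _ [set x | exists a y, genmod [set` s] y /\ x = a *: g + y]).
  split=> [|x1 x2 [a1 [y1 [h1 ->]]] [a2 [y2 [h2 ->]]]|a _ [b [y [h ->]]]].
  - by exists 0, 0; rewrite scale0r addr0; split=> //; exact: submod0.
  - exists (a1 + a2), (y1 + y2); rewrite scalerDl addrACA; split=> //.
    exact: submodD.
  - exists (a * b), (a *: y); rewrite scalerDr scalerA; split=> //.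
    exact: submodZ.
move=> {}x /= /[!inE] /orP[/eqP->|].
  by exists 1, 0; rewrite scale1r addr0; split=> //; exact: submod0.
by move=> xs; exists 0, x; rewrite scale0r add0r; split=> //; exact: sub_gen.
Qed.

Lemma genmod_nil M x : genmod [set` ([::] : seq M)] x -> x = 0.
Proof.
apply: (@gen_min R M _ [set 0]) => //.
by split=> // [_ _ -> ->|a _ ->]; rewrite ?addr0 ?scaler0.
Qed.

Lemma genmod_sub M (s : seq M) (W : submod M) :
  (forall x, x \in s -> W x) -> forall x, genmod [set` s] x -> W x.
Proof. by move=> h; apply: gen_min => //; exact: submodP. Qed.

Lemma genmod_head M (g : M) s : genmod [set` g :: s] g.
Proof. by apply: sub_gen => /=; rewrite mem_head. Qed.

Lemma genmod_tail M (g : M) s x : genmod [set` s] x -> genmod [set` g :: s] x.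
Proof.
by apply: genmod_sub => y ys; apply: sub_gen => /=; rewrite in_cons ys orbT.
Qed.

Lemma mulmod_in (I : ideal R) M (W : submod M) a y :
  I a -> W y -> mulmod I W (a *: y).
Proof. by move=> Ia Wy; apply: sub_gen; exists a, y. Qed.

Lemma mulmod_min (I : ideal R) M (W V : submod M) :
  (forall a y, I a -> W y -> V (a *: y)) -> forall x, mulmod I W x -> V x.
Proof.
move=> h; apply: gen_min; first exact: submodP.
by move=> _ [a [y [Ia Wy ->]]]; exact: h.
Qed.

Lemma mulmod_mono (I K : ideal R) M (W V : submod M) :
  (forall a, I a -> K a) -> (forall x, W x -> V x) ->
  forall x, mulmod I W x -> mulmod K V x.
Proof. by move=> hI hW; apply: mulmod_min => a y /hI Ka /hW; exact: mulmod_in. Qed.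

Lemma mulmod_sub (I : ideal R) M (W : submod M) x : mulmod I W x -> W x.
Proof. by apply: mulmod_min => a y _; exact: submodZ. Qed.

(** The coefficients form a function on all of [nat] with values in [K], so that those chosen at
    successive levels can later be summed as series. *)
Lemma mulmod_coef (K : ideal R) M (s : seq M) x :
  mulmod K (genmod [set` s]) x ->
  exists c : nat -> R, (forall i, K (c i)) /\ x = \sum_(i < size s) c i *: s`_i.
Proof.
pose B := [set x | exists c : nat -> R, (forall i, K (c i)) /\
  x = \sum_(i < size s) c i *: s`_i].
have sB : is_submod B.
  split=> [|y z [c [hc ->]] [d [hd ->]]|a y [c [hc ->]]].
  - exists (fun=> 0); split=> [_|]; first exact: submod0.
    by rewrite big1 // => i _; rewrite scale0r.
  - exists (fun i => c i + d i); split=> [i|]; first exact: submodD.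
    by rewrite -big_split; apply: eq_bigr => i _; rewrite scalerDl.
  - exists (fun i => a * c i); split=> [i|]; first exact: ideal_mull.
    by rewrite scaler_sumr; apply: eq_bigr => i _; rewrite scalerA.
apply: (@gen_min R M _ B) => // _ [a [y [Ka Wy ->]]].
have sa : @is_submod R M [set y | B (a *: y)].
  case: sB => B0 BD BZ; split=> [|y1 y2 h1 h2|b y1 h1] /=.
  - by rewrite scaler0.
  - by rewrite scalerDr; apply: BD.
  - by rewrite scalerA mulrC -scalerA; apply: BZ.
suff h : forall z, genmod [set` s] z -> [set y | B (a *: y)] z by exact: h.
(* [s] may contain [g] several times; [index] puts the coefficient on the first occurrence only. *)
apply: (@gen_min R M _ [set y | B (a *: y)]) => // g /= gs; exists (fun i => if i == index g s then a else 0); split=> [i|].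
  by case: ifP => // _; exact: submod0.
have gi : (index g s < size s)%N by rewrite index_mem.
rewrite (bigD1 (Ordinal gi)) //= eqxx nth_index // big1 ?addr0 // => i ne.
case: ifP => [/eqP e|]; last by rewrite scale0r.
by case/eqP: ne; exact: val_inj.
Qed.

Lemma genmod_coef M (s : seq M) x : genmod [set` s] x ->
  exists c : nat -> R, x = \sum_(i < size s) c i *: s`_i.
Proof.
move=> hx; have [|c [_ ->]] := @mulmod_coef (fullmod R^o) _ s x; last by exists c.
by rewrite -[x]scale1r; exact: mulmod_in.
Qed.

Lemma genmod_comb M (s : seq M) (c : nat -> R) :
  genmod [set` s] (\sum_(i < size s) c i *: s`_i).
Proof.
apply: sum_mem => i; apply: submodZ; apply: sub_gen => /=.
by rewrite mem_nth.
Qed.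

Lemma mulmodA (I K : ideal R) M (W : submod M) x :
  mulmod (@mulmod R R^o I K) W x <-> mulmod I (mulmod K W) x.
Proof.
split.
  apply: mulmod_min => a y + Wy; move: a.
  apply: (@gen_min R R^o _ [set a : R | mulmod I (mulmod K W) (a *: y)]).
    split=> [|a b ha hb|a b hb] /=; first by rewrite scale0r; exact: submod0.
      by rewrite scalerDl; exact: submodD.
    by rewrite -[a *: b]/(a * b) -scalerA; exact: submodZ.
  move=> _ [a [b [Ia Kb ->]]] /=; rewrite -[a *: b]/(a * b) -scalerA.
  by apply: mulmod_in => //; exact: mulmod_in.
apply: mulmod_min => a y Ia.
apply: (@gen_min R M _ [set y | mulmod (@mulmod R R^o I K) W (a *: y)]).
  split=> [|y1 y2 h1 h2|b y1 h1] /=; first by rewrite scaler0; exact: submod0.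
    by rewrite scalerDr; exact: submodD.
  by rewrite scalerA mulrC -scalerA; exact: submodZ.
move=> _ [b [z [Kb Wz ->]]] /=; rewrite scalerA.
apply: mulmod_in => //; exact: (@mulmod_in I R^o K a b).
Qed.

Lemma mulmod_full M (W : submod M) x : mulmod (fullmod R^o) W x <-> W x.
Proof.
split; first exact: mulmod_sub.
by move=> Wx; rewrite -[x]scale1r; exact: mulmod_in.
Qed.

Lemma mexpD (I : ideal R) M (W : submod M) m n x :
  mulmod (ideal_exp I (m + n)) W x <->
  mulmod (ideal_exp I m) (mulmod (ideal_exp I n) W) x.
Proof.
elim: m x => [|m ih] x; first by rewrite mulmod_full.
rewrite !(mulmodA I); split; apply: mulmod_mono => // y; by rewrite ih.
Qed.

Lemma exp_le (I : ideal R) m n a : (m <= n)%N -> ideal_exp I n a -> ideal_exp I m a.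
Proof.
move=> /subnK <-; elim: (n - m)%N => // k ih; rewrite addSn => /ideal_expS.
exact: ih.
Qed.

Lemma exp_mono (I K : ideal R) n a : (forall b, I b -> K b) ->
  ideal_exp I n a -> ideal_exp K n a.
Proof.
move=> h; elim: n a => // n ih a.
by apply: (@mulmod_mono I K R^o).
Qed.

Lemma exprn_mem (I : ideal R) n a : I a -> ideal_exp I n (a ^+ n).
Proof.
move=> Ia; elim: n => // n ih; rewrite exprS.
exact: (@mulmod_in I R^o _ a _ Ia ih).
Qed.

Lemma adic_le (I : ideal R) M m n x : (m <= n)%N -> adic I M n x -> adic I M m x.
Proof. by move=> mn; apply: mulmod_mono => // a; exact: exp_le. Qed.

Lemma adicD (I : ideal R) M m n x :
  adic I M (m + n) x <-> mulmod (ideal_exp I m) (adic I M n) x.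
Proof. exact: mexpD. Qed.

Lemma adicP (I : ideal R) n (a : R) : adic I R^o n a <-> ideal_exp I n a.
Proof.
split; first exact: (@mulmod_min _ R^o (fullmod R^o) (ideal_exp I n) (fun a b Ia _ => ideal_mulr b Ia)).
by move=> h; rewrite -[a]mulr1; exact: (@mulmod_in _ R^o (fullmod R^o) a 1).
Qed.

Section Constructions.
Variable M : lmodType R.
Implicit Types V W : submod M.

Fact smsum_subproof V W :
  is_submod [set x : M | exists v w, [/\ V v, W w & x = v + w]].
Proof.
split=> [|_ _ [v [w [Vv Ww ->]]] [v' [w' [Vv' Ww' ->]]]|a _ [v [w [Vv Ww ->]]]].
- by exists 0, 0; rewrite addr0; split=> //; exact: submod0.
- by exists (v + v'), (w + w'); rewrite addrACA; split=> //; exact: submodD.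
- by exists (a *: v), (a *: w); rewrite scalerDr; split=> //; exact: submodZ.
Qed.
Definition smsum V W : submod M := Submod (smsum_subproof V W).

Lemma smsuml V W x : V x -> smsum V W x.
Proof. by move=> Vx; exists x, 0; rewrite addr0; split=> //; exact: submod0. Qed.
Lemma smsumr V W x : W x -> smsum V W x.
Proof. by move=> Vx; exists 0, x; rewrite add0r; split=> //; exact: submod0. Qed.

Fact line_subproof (x : M) : is_submod [set y : M | exists a : R, y = a *: x].
Proof.
split=> [|_ _ [a ->] [b ->]|b _ [a ->]].
- by exists 0; rewrite scale0r.
- by exists (a + b); rewrite scalerDl.
- by exists (b * a); rewrite scalerA.
Qed.
Definition line x : submod M := Submod (line_subproof x).

Lemma line_id x : line x x.
Proof. by exists 1; rewrite scale1r. Qed.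

Fact sat_subproof (Q : spec R) V :
  is_submod [set x : M | exists s, ~ Q s /\ V (s *: x)].
Proof.
split=> [|x y [s [Qs Vx]] [t [Qt Vy]]|a x [s [Qs Vx]]].
- by exists 1; rewrite scaler0; split; [exact: prime1|exact: submod0].
- exists (s * t); split; first exact: primeNM.
  rewrite scalerDr; apply: submodD; last by rewrite -scalerA; exact: submodZ.
  by rewrite mulrC -scalerA; exact: submodZ.
- by exists s; split=> //; rewrite scalerA mulrC -scalerA; exact: submodZ.
Qed.
Definition sat (Q : spec R) V : submod M := Submod (sat_subproof Q V).

Lemma sat_sub Q V x : V x -> sat Q V x.
Proof. by move=> Vx; exists 1; rewrite scale1r; split=> //; exact: prime1. Qed.

Definition saturated (Q : spec R) V := forall s x, ~ Q s -> V (s *: x) -> V x.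

Lemma sat_saturated Q V : saturated Q (sat Q V).
Proof.
move=> s x Qs [t [Qt Vx]]; exists (t * s); rewrite -scalerA.
by split=> //; exact: primeNM.
Qed.

Lemma sat_min Q V W : saturated Q W -> (forall x, V x -> W x) ->
  forall x, sat Q V x -> W x.
Proof. by move=> hW h x [s [Qs /h]]; exact: hW. Qed.

Lemma sat_mono Q V W : (forall x, V x -> W x) ->
  forall x, sat Q V x -> sat Q W x.
Proof. by move=> h x [s [Qs /h Wx]]; exists s. Qed.

Fact colon_subproof V W : @is_submod R R^o [set a : R | forall x, W x -> V (a *: x)].
Proof.
split=> [x _|a b ha hb x Wx|a b hb x Wx].
- by rewrite scale0r; exact: submod0.
- by rewrite scalerDl; apply: submodD; [exact: ha|exact: hb].
- by rewrite -[a *: b]/(a * b) -scalerA; apply: submodZ; exact: hb.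
Qed.
Definition colon V W : ideal R := Submod (colon_subproof V W).

Fact divby_subproof V (a : R) : is_submod [set x : M | V (a *: x)].
Proof.
split=> [|x y Vx Vy|b x Vx] /=.
- by rewrite scaler0; exact: submod0.
- by rewrite scalerDr; exact: submodD.
- by rewrite scalerA mulrC -scalerA; exact: submodZ.
Qed.
Definition divby V a : submod M := Submod (divby_subproof V a).

Fact zero_subproof : @is_submod R M [set 0].
Proof. by split=> // [_ _ -> ->|a _ ->]; rewrite ?addr0 ?scaler0. Qed.
Definition zeromod : submod M := Submod zero_subproof.

Fact union_subproof (W : nat -> submod M) :
  (forall n x, W n x -> W n.+1 x) -> is_submod [set x : M | exists n, W n x].
Proof.
move=> h; have hle m n x : (m <= n)%N -> W m x -> W n x.
  by move=> /subnK<-; elim: (n - m)%N => // k ih /ih; rewrite addSn; exact: h.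
split=> [|x y [m Wx] [n Wy]|a x [n Wx]].
- by exists 0%N; exact: submod0.
- exists (maxn m n); apply: submodD; [apply: hle Wx|apply: hle Wy].
    exact: leq_maxl.
  exact: leq_maxr.
- by exists n; exact: submodZ.
Qed.

End Constructions.

Definition noethM M := forall W : submod M,
  exists s : seq M, forall x, W x <-> genmod [set` s] x.

Lemma noeth_ring : noetherian R -> noethM R^o.
Proof. by move=> h W; have [s e] := h W; exists s => x; rewrite e. Qed.

(** Induction on the generators: [W] is controlled by the ideal of the coefficients that [g] takes
    in [W] and by the part of [W] in the span of the other generators. *)
Lemma noeth_fg M : noetherian R -> fin_gen M -> noethM M.
Proof.
move=> nR [s0 es0].
suff : forall (s : seq M) (W : submod M), (forall x, W x -> genmod [set` s] x) ->
    exists s : seq M, forall x, W x <-> genmod [set` s] x.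
  by move=> h W; apply: (h s0) => x _; rewrite es0.
move=> {s0 es0}; elim=> [|g s ih] W hW.
  exists [::] => x; split=> [/hW//|/genmod_nil->]; exact: submod0.
have sA : @is_submod R R^o [set a : R | exists2 y, genmod [set` s] y & W (a *: g + y)].
  split=> [|a b [y hy Wy] [z hz Wz]|a b [y hy Wy]].
  - by exists 0; rewrite ?scale0r ?addr0; exact: submod0.
  - by exists (y + z); [exact: submodD|rewrite scalerDl addrACA; exact: submodD].
  - exists (a *: y); first exact: submodZ.
    by rewrite -[a *: b]/(a * b) -scalerA -scalerDr; exact: submodZ.
have [t et] := nR (Submod sA).
have sC : is_submod [set x : M | W x /\ genmod [set` s] x].
  split=> [|x y [? ?] [? ?]|a x [? ?]].
  - by split; exact: submod0.
  - by split; exact: submodD.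
  - by split; exact: submodZ.
have [|u eu] := ih (Submod sC); first by move=> x [].
(* Each generator of the coefficient ideal is realized by an element of [W]. *)
have lift : forall r : seq R, (forall a, a \in r -> Submod sA a) ->
   exists v : seq M, (forall x, x \in v -> W x) /\
     forall a, @genmod R R^o [set` r] a ->
       exists2 y, genmod [set` s] y & genmod [set` v] (a *: g + y).
  elim=> [_|a r ihr har].
    exists [::]; split=> // a /(@genmod_nil R^o) ->; exists 0; first exact: submod0.
    by rewrite scale0r addr0; exact: submod0.
  have [v [Wv hv]] := ihr (fun b br => har b (mem_behead (s := a :: r) br)).
  have [y hy Wy] := har a (mem_head _ _).
  exists (a *: g + y :: v); split=> [x|b /(@genmod_cons R^o)[c [d [/hv[z hz hdz] ->]]]].
    by rewrite in_cons => /orP[/eqP->//|]; exact: Wv.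
  exists (c *: y + z); first by apply: submodD => //; exact: submodZ.
  rewrite scalerDl addrACA; apply: submodD; last exact: genmod_tail.
  by rewrite -[c *: (a : R^o)]/(c * a) -scalerA -scalerDr; apply: submodZ; exact: genmod_head.
have [|v [Wv hv]] := lift t.
  by move=> a at_; rewrite et; exact: sub_gen.
exists (u ++ v) => x; split=> [Wx|]; last first.
  apply: genmod_sub => y; rewrite mem_cat => /orP[yu|]; last exact: Wv.
  by have [_] := eu y; case=> //; exact: sub_gen.
have [a [y [hy ex]]] := genmod_cons (hW x Wx).
have : Submod sA a by exists y => //; rewrite -ex.
rewrite et => /hv[z hz hv'].
have Wz : W (a *: g + z) by move: hv'; exact: genmod_sub.
have -> : x = (y - z) + (a *: g + z) by rewrite ex [RHS]addrACA addNr addr0 addrC.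
apply: submodD.
  have : Submod sC (y - z).
    split; last exact: submodB.
    have -> : y - z = x - (a *: g + z) by rewrite ex opprD addrACA subrr add0r.
    exact: submodB.
  rewrite eu; apply: genmod_sub => w wu; apply: sub_gen => /=.
  by rewrite mem_cat wu.
move: hv'; apply: genmod_sub => w wv; apply: sub_gen => /=.
by rewrite mem_cat wv orbT.
Qed.

Lemma noeth_acc M (W : nat -> submod M) : noethM M ->
  (forall n x, W n x -> W n.+1 x) ->
  exists n, forall m x, W m x -> W n x.
Proof.
move=> nM hW; have hle m n x : (m <= n)%N -> W m x -> W n x.
  by move=> /subnK<-; elim: (n - m)%N => // k ih /ih; rewrite addSn; exact: hW.
have [s es] := nM (Submod (union_subproof hW)).
have [n hn] : exists n, forall x, x \in s -> W n x.
  have: forall x, x \in s -> exists n, W n x by move=> x /(@sub_gen R M [set` s]) /es.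
  elim: s {es} => [|g s ih] h; first by exists 0%N.
  have [m Wg] := h g (mem_head _ _).
  have [n Wn] := ih (fun x xs => h x (mem_behead (s := g :: s) xs)).
  exists (maxn m n) => x; rewrite in_cons => /orP[/eqP->|/Wn].
    by apply: hle Wg; exact: leq_maxl.
  by apply: hle; exact: leq_maxr.
exists n => m x Wx; have : Submod (union_subproof hW) x by exists m.
by rewrite es; exact: genmod_sub.
Qed.

Lemma noeth_max M (P : submod M -> Prop) W0 : noethM M -> P W0 ->
  exists W, P W /\ forall V, P V -> (forall x, W x -> V x) -> forall x, V x -> W x.
Proof.
move=> nM P0; apply: contrapT => hno.
have step : forall W : {W | P W}, exists V : {W | P W},
    (forall x, sval W x -> sval V x) /\ ~ (forall x, sval V x -> sval W x).
  move=> [W PW]; apply: contrapT => h; apply: hno; exists W; split=> // V PV WV.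
  by apply: contrapT => VW; apply: h; exists (exist _ V PV).
have [f hf] := choice step.
pose F n := iter n f (exist _ W0 P0).
have [|n hn] := @noeth_acc M (fun n => sval (F n)) nM.
  by move=> n; have [] := hf (F n).
by have [_] := hf (F n); apply => x; exact: (hn n.+1 x).
Qed.

(** The product of one denominator for each generator of [W] serves all of [W]. *)
Lemma sat_common M (Q : spec R) (V W : submod M) : noethM M ->
  (forall x, W x -> sat Q V x) -> exists s, ~ Q s /\ forall x, W x -> V (s *: x).
Proof.
move=> nM; have [g eg] := nM W => h.
have {h}: forall x, x \in g -> sat Q V x by move=> x xg; apply: h; apply/eg; exact: sub_gen.
have {eg} : forall x, W x -> genmod [set` g] x by move=> x /eg.
elim: g W => [|x g ih] W hW h.
  exists 1; split=> [|x /hW /genmod_nil->]; first exact: prime1.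
  by rewrite scaler0; exact: submod0.
have [s [Qs Vs]] := h x (mem_head _ _).
have [//||t [Qt Vt]] := ih (genmod [set` g]) _ _.
  by move=> y yg; apply: h; rewrite in_cons yg orbT.
exists (s * t); split; first exact: primeNM.
move=> y /hW /genmod_cons[a [z [hz ->]]]; rewrite scalerDr; apply: submodD.
  rewrite scalerA (_ : s * t * a = (t * a) * s); last by ring.
  by rewrite -scalerA; exact: submodZ.
by rewrite -scalerA; apply: submodZ; exact: Vt.
Qed.

End Submodules.

(** * Noetherian rings *)

Section NoetherianRings.
Variables (R : comPzRingType) (nR : noetherian R).
Implicit Types (M : lmodType R) (Q P : spec R).

Let nR' : noethM R^o := noeth_ring nR.

(** An ideal maximal among those that contain [C] and miss the multiplicative set [S] is prime. *)
Lemma prime_disjoint (C : ideal R) (S : set R) :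
  S 1 -> (forall a b, S a -> S b -> S (a * b)) -> (forall a, C a -> ~ S a) ->
  exists q : spec R, (forall a, C a -> q a) /\ forall a, q a -> ~ S a.
Proof.
move=> S1 SM CS.
pose P (W : ideal R) := (forall a, C a -> W a) /\ forall a, W a -> ~ S a.
have [|W [[CW WS] hmax]] := @noeth_max R R^o P C nR'; first by split.
have pW : is_prime W.
  split=> [/WS//|a b Wab]; apply: contrapT => /not_orP[Wa Wb].
  have big c : ~ W c -> exists w r, W w /\ S (w + r * c).
    move=> Wc; apply: contrapT => hno; apply: Wc.
    apply: (hmax (@smsum R R^o W (line (c : R^o)))); last exact/smsumr/line_id.
      split=> [x /CW Wx|_ [w [_ [Ww [r ->] ->]]] Sx]; first exact: smsuml.
      by apply: hno; exists w, r.
    by move=> x; exact: smsuml.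
  have [w [r [Ww Sw]]] := big a Wa; have [v [t [Wv Sv]]] := big b Wb.
  apply: WS (SM _ _ Sw Sv).
  have -> : (w + r * a) * (v + t * b) = (v + t * b) * w + (r * a) * v + r * t * (a * b) by ring.
  by apply: submodD; [apply: submodD|]; exact: ideal_mull.
by exists (Spec pW).
Qed.

Lemma mulmod_cons (K : ideal R) M (g : M) s x : mulmod K (genmod [set` g :: s]) x ->
  exists a y, [/\ K a, mulmod K (genmod [set` s]) y & x = a *: g + y].
Proof.
apply: (@gen_min R M _ [set x | exists a y,
   [/\ K a, mulmod K (genmod [set` s]) y & x = a *: g + y]]).
  split=> [|_ _ [a [y [Ka Vy ->]]] [b [z [Kb Vz ->]]]|b _ [a [y [Ka Vy ->]]]].
  - by exists 0, 0; rewrite scale0r addr0; split=> //; exact: submod0.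
  - exists (a + b), (y + z); rewrite scalerDl addrACA; split=> //; exact: submodD.
  - exists (b * a), (b *: y); rewrite scalerDr scalerA; split=> //; last exact: submodZ.
    exact: ideal_mull.
move=> _ [a [_ [Ka /genmod_cons[b [y [hy ->]]] ->]]].
exists (a * b), (a *: y); rewrite scalerDr scalerA; split=> //; last exact: mulmod_in.
exact: ideal_mulr.
Qed.

(* Nakayama's lemma for the localizations of W and V at Q. *)
Lemma nakayama_sat M Q (V W : submod M) : noethM M ->
  (forall w, W w -> sat Q (smsum V (mulmod Q W)) w) ->
  forall w, W w -> sat Q V w.
Proof.
move=> nM h; have [s es] := nM W.
have gen (r : seq M) : (forall w, w \in r -> sat Q (smsum V (mulmod Q (genmod [set` r]))) w) ->
    forall w, w \in r -> sat Q V w.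
  elim: r => [//|g r ih] hr.
  have [c [Qc [v [_ [Vv /mulmod_cons[q [u [Qq Vu ->]]] ev]]]]] := hr g (mem_head _ _).
  (* The relation c g = v + q g + u is solved for g; c - q is a unit locally at [Q]. *)
  have Qcq : ~ Q (c - q).
    by move=> Qd; apply: Qc; rewrite -(subrK q c); exact: submodD.
  have eg : (c - q) *: g = v + u.
    by rewrite scalerBl ev addrCA addrAC subrr add0r.
  have {}ih : forall w, w \in r -> sat Q V w.
    apply: ih => w wr.
    have [|d [Qd [v' [_ [Vv' /mulmod_cons[q' [u' [Qq' Vu' ->]]] ev']]]]] := hr w.
      by rewrite in_cons wr orbT.
    (* Multiplication by c - q turns q' g into q' (v + u), which eliminates [g] from the relation
       for [w]. *)
    exists ((c - q) * d); split; first exact: primeNM.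
    exists ((c - q) *: v' + q' *: v), (q' *: u + (c - q) *: u'); split.
    - by apply: submodD; exact: submodZ.
    - by apply: submodD; exact: submodZ.
    - rewrite -scalerA ev' 2!scalerDr scalerA [_ * q']mulrC -scalerA eg scalerDr.
      by rewrite !addrA.
  move=> w; rewrite in_cons => /orP[/eqP->|]; last exact: ih.
  apply: (@sat_saturated _ _ Q V (c - q)) => //; rewrite eg.
  apply: submodD; first exact: sat_sub.
  by move: (mulmod_sub Vu); exact: genmod_sub.
move=> w /es; apply: genmod_sub => g gs; apply: (gen s) => // {}g {}gs.
have /es/h : genmod [set` s] g by exact: sub_gen.
apply: sat_mono => y [v [x [Vv Wx ->]]]; exists v, x; split=> //.
by move: Wx; apply: mulmod_mono => // z /es.
Qed.

Lemma line_mul (W : ideal R) (b w w' r r' : R) : W w -> W w' -> W (b * b) ->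
  W ((w + r * b) * (w' + r' * b)).
Proof.
move=> Ww Ww' Wb.
have -> : (w + r * b) * (w' + r' * b) =
  (w' + r' * b) * w + (r * b) * w' + r * r' * (b * b) by ring.
by apply: submodD; [apply: submodD|]; exact: ideal_mull.
Qed.

(** Noetherian induction on [C]: a maximal counterexample [W] misses some a in [I], and a power b of
    a gives a larger ideal W + Rb whose square lies in [W]. *)
Lemma powers_sub (C I : ideal R) : (forall a, I a -> exists n, C (a ^+ n)) ->
  exists k, forall a, ideal_exp I k a -> C a.
Proof.
move=> hI; apply: contrapT => hC.
pose P (W : ideal R) := (forall a, C a -> W a) /\
  ~ exists k, forall a, ideal_exp I k a -> W a.
have [|W [[CW hW] hmax]] := @noeth_max R R^o P C nR'; first by split.
apply: hW; have [IW|/existsNP[a /not_implyP[Ia Wa]]] := EM (forall a, I a -> W a).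
  by exists 1%N => a; apply: (@mulmod_min R I R^o) => b y Ib _; exact/IW/ideal_mulr.
(* a^(m+1) is the last power of a outside [W], so its square is in [W]. *)
have [m [Wm WSm]] : exists m, ~ W (a ^+ m.+1) /\ W (a ^+ m.+2).
  have [n /CW] := hI a Ia; elim: n => [|n ih] Wn.
    by case: Wa; rewrite -[a]mulr1; apply: ideal_mull.
  have [Wn'|Wn'] := EM (W (a ^+ n)); first exact: ih.
  by case: n Wn Wn' {ih} => [|n] Wn Wn'; [rewrite expr1 in Wn|exists n].
pose b := a ^+ m.+1.
have Wbb : W (b * b).
  by rewrite /b -exprD addSnnS addnC exprD; apply: ideal_mulr.
pose W' := @smsum R R^o W (line (b : R^o)).
have [k hk] : exists k, forall a, ideal_exp I k a -> W' a.
  apply: contrapT => hk; apply: Wm; apply: (hmax W').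
  - by split=> // x /CW; exact: smsuml.
  - by move=> x; exact: smsuml.
  - exact/smsumr/line_id.
exists (k + k)%N => x /(adicP I) /adicD.
apply: (@mulmod_min R (ideal_exp I k) R^o) => u v /hk hu /adicP /hk hv.
case: hu => w [_ [Ww [r ->] ->]]; case: hv => w' [_ [Ww' [r' ->] ->]].
exact: line_mul.
Qed.

(** Locally at [P] no prime over [C] other than [P] remains, so every element of [P] is nilpotent
    modulo [C]. If no prime below [P] contains [C] at all, [C] is locally the unit ideal and the
    conclusion still holds. *)
Lemma min_prime_pow (C : ideal R) P :
  (forall q : spec R, (forall a, C a -> q a) -> (forall a, q a -> P a) ->
    forall a, P a -> q a) ->
  exists e, forall a, ideal_exp P e a -> @sat R R^o P C a.
Proof.
move=> hP; apply: powers_sub => a Pa; apply: contrapT => hno.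
(* A prime that misses [S] lies inside [P] and does not contain a. *)
pose S := [set x : R | exists s n, ~ P s /\ x = s * a ^+ n].
have [|x y [s [m [Ps ->]]] [t [n [Pt ->]]]|x Cx [s [n [Ps ex]]]|q [Cq qS]] :=
    @prime_disjoint C S.
- by exists 1, 0%N; rewrite mulr1; split=> //; exact: prime1.
- by exists (s * t), (m + n)%N; rewrite mulrACA exprD; split=> //; exact: primeNM.
- by apply: hno; exists n, s; rewrite -[_ *: _]/(s * a ^+ n) -ex.
- have qP x : q x -> P x.
    move=> qx; apply: contrapT => Px; apply: (qS x qx).
    by exists x, 0%N; rewrite mulr1.
  apply: (qS a); first exact: hP.
  by exists 1, 1%N; rewrite mul1r; split=> //; exact: prime1.
Qed.

(** Locally at [Q] the module V 0 / W0 has finite length. Noetherian induction on the lower bound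
    replaces the length: a maximal bad bound [W] is enlarged by one local simple layer. *)
Lemma dcc_sat M Q (W0 : submod M) (V : nat -> submod M) : noethM M ->
  saturated Q W0 ->
  (forall k, saturated Q (V k)) -> (forall k x, V k.+1 x -> V k x) ->
  (forall k x, W0 x -> V k x) ->
  (exists e, forall x, mulmod (ideal_exp Q e) (V 0%N) x -> W0 x) ->
  exists n, forall k x, (n <= k)%N -> V n x -> V k x.
Proof.
move=> nM sW0 sV dV WV hE; apply: contrapT => hno.
pose P (W : submod M) := saturated Q W /\ exists V : nat -> submod M,
  [/\ forall k, saturated Q (V k), forall k x, V k.+1 x -> V k x,
   forall k x, W x -> V k x,
   exists e, forall x, mulmod (ideal_exp Q e) (V 0%N) x -> W x &
   ~ exists n, forall k x, (n <= k)%N -> V n x -> V k x].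
have [|W [[sW {V sV dV WV hE hno} [V [sV dV WV [e hE] hno]]] hmax]] :=
  @noeth_max R M P W0 nM; first by split=> //; exists V.
have hle m n x : (m <= n)%N -> V n x -> V m x.
  by move=> /subnK<-; elim: (n - m)%N => // k ih; rewrite addSn => /dV.
(* The socle element: x spans a simple module over [W] locally at [Q]. *)
have [x [Vx Wx Qx]] : exists x, [/\ V 0%N x, ~ W x & forall a, Q a -> W (a *: x)].
  elim: e hE => [|e ih] hE.
    case: hno; exists 0%N => k x _ Vx; apply: WV; apply: hE.
    exact/mulmod_full.
  have [/ih//|/existsNP[x /not_implyP[hx Wx]]] := EM (forall x, mulmod (ideal_exp Q e) (V 0%N) x -> W x).
  exists x; split=> // [|a Qa]; first exact: mulmod_sub hx.
  by apply: hE; apply/(mulmodA Q); exact: mulmod_in.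
pose W' := sat Q (smsum W (line x)).
have WW' y : W y -> W' y by move=> Wy; apply/sat_sub/smsuml.
have W'x : W' x by apply/sat_sub/smsumr/line_id.
have notP : ~ P W' by move=> /hmax h; apply: Wx; exact: h.
have W'V0 y : W' y -> V 0%N y.
  apply: sat_min => // _ [w [_ [Ww [a ->] ->]]]; apply: submodD; first exact: WV.
  exact: submodZ.
(* If x is in every V k, the same chain lies over the larger bound [W']. Otherwise V k + W'
   stabilizes by maximality, and V k meets [W'] only in [W] once x has left the chain. *)
have [hx|/existsNP[n2 hn2]] := EM (forall k, V k x).
  apply: notP; split; first exact: sat_saturated.
  exists V; split=> //.
    move=> k; apply: sat_min => // _ [w [_ [Ww [a ->] ->]]].
    by apply: submodD; [exact: WV|exact: submodZ].
  by exists e => y /hE /WW'.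
pose V' k := sat Q (smsum (V k) W').
have [n1 hn1] : exists n, forall k x, (n <= k)%N -> V' n x -> V' k x.
  apply: contrapT => hno'; apply: notP; split; first exact: sat_saturated.
  exists V'; split=> //.
  - by move=> k; exact: sat_saturated.
  - move=> k; apply: sat_mono => _ [v [w [Vv Ww ->]]].
    by apply: submodD; [exact/smsuml/dV|exact/smsumr].
  - by move=> k y Wy; apply/sat_sub/smsumr.
  - exists e => y hy; apply: WW'; apply: hE; move: hy; apply: mulmod_mono => //.
    by apply: sat_min => // _ [v [w [Vv Ww ->]]]; apply: submodD => //; exact: W'V0.
apply: hno; exists (maxn n1 n2) => k v hk Vv.
have Vk : V' k v.
  apply: (hn1 k); first exact: leq_trans (leq_maxl _ _) hk.
  by apply/sat_sub/smsuml; apply: hle Vv; exact: leq_maxl.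
have [s [Qs [vk [w' [Vvk [s' [Qs' [w [_ [Ww [b ->] ew]]]]] ev]]]]] := Vk.
have e1 : (s' * s) *: v = s' *: vk + w + b *: x.
  by rewrite -scalerA ev scalerDr ew addrA.
have Vbx : V n2 (b *: x).
  have -> : b *: x = (s' * s) *: v - (s' *: vk + w) by rewrite e1 addrC addKr.
  apply: submodB.
    by apply: submodZ; apply: hle Vv; exact: leq_maxr.
  apply: submodD; last exact: WV.
  by apply: submodZ; apply: hle Vvk; apply: leq_trans hk; exact: leq_maxr.
(* For b outside [Q], saturation would put x back into V n2. *)
have [Qb|Qb] := EM (Q b); last by case: hn2; exact: sV Vbx.
apply: (sV k (s' * s)); first exact: primeNM.
rewrite e1; apply: submodD; last exact/WV/Qx.
by apply: submodD; [exact: submodZ|exact: WV].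
Qed.

End NoetherianRings.

(** * Krull's height theorem *)

(** Classical equality of primes, so that finite lists of primes have a membership predicate. *)
HB.instance Definition _ (R : comPzRingType) := gen_eqMixin (spec R).

Section KrullHeight.
Variables (R : comPzRingType) (nR : noetherian R).
Implicit Types (P Q : spec R).

Let nR' : noethM R^o := noeth_ring nR.

Let isum (I K : ideal R) : ideal R := @smsum R R^o I K.
Let principal (x : R) : ideal R := @line R R^o x.

(* Compares the symbolic powers of P1 modulo P0, which stabilize locally at Q
   modulo x. *)
Lemma principal_ideal_thm (P0 P1 Q : spec R) (x : R) :
  (forall a, P0 a -> P1 a) -> ~ (forall a, P1 a -> P0 a) ->
  (forall a, P1 a -> Q a) -> ~ (forall a, Q a -> P1 a) -> Q x ->
  ~ (forall q : spec R, (forall a, P0 a -> q a) -> q x -> (forall a, q a -> Q a) ->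
     forall a, Q a -> q a).
Proof.
move=> P01 nP10 P1Q nQP1 Qx minQ.
have P1x : ~ P1 x by move=> P1x; apply: nQP1; exact: minQ.
have Qs s : ~ Q s -> ~ P1 s by move=> h /P1Q.
pose C := isum P0 (principal x).
pose F n : ideal R := @sat R R^o P1 (isum (ideal_exp P1 n) P0).
pose G n : ideal R := @sat R R^o Q (isum (F n) C).
have FS n a : F n.+1 a -> F n a.
  apply: sat_mono => _ [u [v [Pu Pv ->]]]; exists u, v; split=> //.
  exact: ideal_expS.
have FP0 n a : P0 a -> F n a by move=> P0a; apply/sat_sub/smsumr.
have [e he] : exists e, forall a, ideal_exp Q e a -> @sat R R^o Q C a.
  apply: min_prime_pow => // q Cq qQ; apply: minQ => //.
    by move=> a P0a; apply/Cq/smsuml.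
  by apply/Cq/smsumr/(@line_id R R^o).
have [n hn] : exists n, forall k a, (n <= k)%N -> G n a -> G k a.
  apply: (@dcc_sat R R^o Q (@sat R R^o Q C)) => //.
  - exact: sat_saturated.
  - by move=> k; exact: sat_saturated.
  - move=> k; apply: sat_mono => _ [u [v [Fu Cv ->]]]; exists u, v; split=> //.
    exact: FS.
  - by move=> k; apply: sat_mono => a Ca; exact: smsumr.
  - exists e; apply: mulmod_min => a y /he [s [Qs' Csa]] _; exists s; split=> //.
    have -> : s *: (a *: y) = y *: (s *: a).
      by rewrite -[LHS]/(s * (a * y)) -[RHS]/(y * (s * a)) mulrA mulrC.
    exact: submodZ.
(* Locally at [Q] an element of F n is b + c x with b in F n.+1, so c x is in F n, and so is c
   because x is outside [P1]. Thus F n = F n.+1 + x F n locally, and Nakayama's lemma applies. *)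
have FF a : F n a -> F n.+1 a.
  move=> Fa; apply: (@sat_min R R^o Q (F n.+1)); last 2 first.
  - exact: id.
  - move: a Fa; apply: nakayama_sat => // a Fa.
    have [s [Qs' [b [_ [Fb [p [_ [P0p [c ->] ->]]] es]]]]] : G n.+1 a.
      by apply: hn => //; apply/sat_sub/smsuml.
    have {}es : s * a = b + (p + c * x) := es.
    exists s; split=> //; exists (b + p), (x * c); split.
    + by apply: submodD => //; exact: FP0.
    + apply: (@mulmod_in R Q R^o (F n) x c) => //.
      apply: (@sat_saturated R R^o P1 _ x) => //.
      have -> : x *: (c : R^o) = s *: (a : R^o) - (b + p : R^o).
        rewrite -![_ *: _]/(_ * _) es; ring.
      apply: submodB; first exact: submodZ.
      apply: submodD; [exact: FS|exact: FP0].
    + rewrite -[_ *: _]/(_ * _) es; ring.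
  - move=> s x0 /Qs; exact: sat_saturated.
(* Locally at [P1] the ideal P1^n now lies in P0 + P1 P1^n, hence in [P0] by Nakayama's lemma. *)
apply: nP10 => a P1a; apply: (@primeX R P0 a n).
have : ideal_exp P1 n (a ^+ n) by exact: exprn_mem.
have: forall b, ideal_exp P1 n b -> @sat R R^o P1 P0 b.
  apply: nakayama_sat => // b Pb.
  have /FF : F n b by apply/sat_sub/smsuml.
  by apply: sat_mono => _ [u [v [Pu P0v ->]]]; exists v, u; rewrite addrC.
move=> h /h [s [P1s /primeM[/P01//|//]]].
Qed.

(** Noetherian induction: if a b is in [W] but neither factor is, every prime over [W] contains W +
    Ra or W + Rb, and the two lists are joined. Some primes of the list may fail to be minimal. *)
Lemma min_prime_list (C : ideal R) : exists L : seq (spec R),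
  (forall q : spec R, q \in L -> forall a, C a -> q a) /\
  (forall q : spec R, (forall a, C a -> q a) ->
     exists2 q', q' \in L & forall a, q' a -> q a).
Proof.
apply: contrapT => hC.
pose P (W : ideal R) := ~ exists L : seq (spec R),
  (forall q : spec R, q \in L -> forall a, W a -> q a) /\
  (forall q : spec R, (forall a, W a -> q a) ->
     exists2 q', q' \in L & forall a, q' a -> q a).
have [W [PW hmax]] := @noeth_max R R^o P C nR' hC.
have W1 : ~ W 1.
  move=> W1; apply: PW; exists [::]; split=> // q Wq.
  by case: (prime1 (Wq 1 W1)).
have [pW|/existsNP[a /existsNP[b /not_implyP[Wab /not_orP[Wa Wb]]]]] :=
  EM (forall a b, W (a * b) -> W a \/ W b).
  have sW : is_prime W by [].
  apply: PW; exists [:: Spec sW]; split=> [q|q Wq]; first by rewrite inE => /eqP->.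
  by exists (Spec sW); rewrite ?inE.
have big c : ~ W c -> ~ P (isum W (principal c)).
  move=> Wc /hmax h; apply: Wc; apply: h; last by apply/smsumr/(@line_id R R^o).
  by move=> x; exact: smsuml.
have [La [La1 La2]] := contrapT (big a Wa).
have [Lb [Lb1 Lb2]] := contrapT (big b Wb).
apply: PW; exists (La ++ Lb); split=> [q|q Wq].
  rewrite mem_cat => /orP[/La1 h|/Lb1 h] x Wx; apply: h; exact: smsuml.
have ext c : q c -> forall x, isum W (principal c) x -> q x.
  move=> qc _ [w [_ [Ww [r ->] ->]]]; apply: submodD; first exact: Wq.
  exact: submodZ.
have [/ext/La2[q' q'L h]|/ext/Lb2[q' q'L h]] := primeM (Wq _ Wab).
  by exists q' => //; rewrite mem_cat q'L.
by exists q' => //; rewrite mem_cat q'L orbT.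
Qed.

(** It suffices to descend within the finite list of [min_prime_list], since every prime over [C]
    contains one of its members. *)
Lemma exists_min_prime (C : ideal R) Q : (forall a, C a -> Q a) ->
  exists P, [/\ forall a, C a -> P a, forall a, P a -> Q a &
    forall q : spec R, (forall a, C a -> q a) -> (forall a, q a -> P a) ->
      forall a, P a -> q a].
Proof.
move=> CQ; have [L [L1 L2]] := min_prime_list C.
have pick (L' : seq (spec R)) Q' : exists P, [/\ P = Q' \/ P \in L', forall a, P a -> Q' a &
   forall q, q \in L' -> (forall a, q a -> P a) -> forall a, P a -> q a].
  elim: L' Q' => [|q L' ih] Q'; first by exists Q'; split=> //; left.
  have [P [PL PQ hP]] := ih Q'.
  have [[qP nPq]|h] := EM ((forall a, q a -> P a) /\ ~ (forall a, P a -> q a)).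
    have [P' [PL' PQ' hP']] := ih q; exists P'; split.
    - by right; rewrite in_cons; case: PL' => [->|->]; rewrite ?eqxx ?orbT.
    - by move=> a /PQ' /qP /PQ.
    - by move=> q'; rewrite in_cons => /orP[/eqP->//|]; exact: hP'.
  exists P; split=> //.
    by case: PL => [->|PL]; [left|right; rewrite in_cons PL orbT].
  move=> q'; rewrite in_cons => /orP[/eqP-> qP|]; last exact: hP.
  by apply: contrapT => nPq; apply: h.
have [Q0 Q0L Q0Q] := L2 Q CQ.
have [P [PL PQ0 hP]] := pick L Q0; exists P; split.
- by apply: L1; case: PL => [->|].
- by move=> a /PQ0 /Q0Q.
- move=> q Cq qP a Pa; have [q' q'L q'q] := L2 q Cq.
  by apply: (q'q); apply: hP => // b /q'q /qP.
Qed.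

End KrullHeight.

(* A chain of n + 1 primes containing K, the largest of which is Q. *)
Fixpoint chainto (R : comPzRingType) (K : set R) (n : nat) (Q : spec R) : Prop :=
  if n is m.+1 then
    exists P : spec R, [/\ forall a, P a -> Q a, ~ (forall a, Q a -> P a)
      & chainto K m P]
  else forall a, K a -> Q a.

Section Chains.
Variable R : comPzRingType.
Implicit Types (P Q : spec R) (K : set R).

Lemma chainto_base K n Q : chainto K n Q -> forall a, K a -> Q a.
Proof. by elim: n Q => //= n ih Q [P [PQ _ /ih h]] a /h /PQ. Qed.

Lemma chainto_up K n P Q : (forall a, P a -> Q a) -> chainto K n P -> chainto K n Q.
Proof.
case: n => [|n] PQ /=; first by move=> h a /h /PQ.
move=> [P' [P'P nPP' h]]; exists P'; split=> //; first by move=> a /P'P /PQ.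
by move=> QP'; apply: nPP' => a /PQ /QP'.
Qed.

Lemma chainto_down (P : spec R) K n Q : (forall a, P a -> K a) ->
  ~ (forall a, K a -> P a) -> chainto K n Q -> @chainto R P n.+1 Q.
Proof.
move=> PK nKP; elim: n Q => [|n ih] Q.
  move=> h; exists P; split=> //; first by move=> a /PK /h.
  by move=> QP; apply: nKP => a /h /QP.
by move=> [P' [? ? /ih ?]]; exists P'.
Qed.

(** From the top down, the primes below [Q] are replaced by primes that contain x; the lowest one is
    lost. *)
Lemma chainto_exchange K n Q x : noetherian R -> chainto K n.+1 Q -> Q x ->
  chainto (K `|` [set x]) n Q.
Proof.
move=> nR; elim: n Q => [|n ih] Q [Q1 [Q1Q nQQ1 h]] Qx.
  by move=> a [/h /Q1Q//|->].
have [Q1x|Q1x] := EM (Q1 x); first by exists Q1; split=> //; exact: ih.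
have [Q2 [Q21 nQ12 h2]] := h.
have [P [CP PQ minP]] : exists P, [/\ forall a, @smsum R R^o Q2 (@line R R^o x) a -> P a,
    forall a, P a -> Q a &
    forall q : spec R, (forall a, @smsum R R^o Q2 (@line R R^o x) a -> q a) ->
      (forall a, q a -> P a) -> forall a, P a -> q a].
  apply: exists_min_prime => // _ [u [_ [Q2u [r ->] ->]]]; apply: submodD.
    exact/Q1Q/Q21.
  exact: submodZ.
have Px : P x by apply/CP/smsumr/(@line_id R R^o).
have Q2P a : Q2 a -> P a by move=> Q2a; exact/CP/smsuml.
exists P; split=> //.
  (* If P were Q, then Q would be minimal over Q2 + Rx in spite of Q2 < Q1 < Q. *)
  move=> QP; apply: (@principal_ideal_thm R nR Q2 Q1 Q x) => //.
  move=> q Q2q qx qQ a Qa; apply: minP => [b||]; last exact: QP.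
    by move=> [u [_ [Q2u [r ->] ->]]]; apply: submodD; [exact: Q2q|exact: submodZ].
  by move=> b /qQ /QP.
apply: ih => //; exists Q2; split=> //.
by move=> PQ2; apply: Q1x; exact/Q21/PQ2.
Qed.

(** Each element of [s] joins [K] and shortens the chain by one; when none is left, [Q] is minimal
    over [K]. With [K] a mere set, joining is a union. *)
Lemma krull_height K (s : seq R) n Q : noetherian R ->
  (forall x, x \in s -> Q x) ->
  (forall P, (forall a, K a -> P a) -> (forall x, x \in s -> P x) ->
     (forall a, P a -> Q a) -> forall a, Q a -> P a) ->
  chainto K n Q -> (n <= size s)%N.
Proof.
move=> nR; elim: s K n => [|x s ih] K [//|n] sQ minQ h.
  have [P [PQ nQP /chainto_base KP]] := h; case: nQP; exact: minQ.
rewrite ltnS; apply: (ih (K `|` [set x])).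
- by move=> y ys; apply: sQ; rewrite in_cons ys orbT.
- move=> P KxP sP PQ; apply: minQ => // [a Ka|y]; first by apply: KxP; left.
  by rewrite in_cons => /orP[/eqP->|/sP//]; apply: KxP; right.
- by apply: chainto_exchange => //; apply: sQ; rewrite mem_head.
Qed.

End Chains.

(** * Associated primes and the intersection theorem *)

Section Associated.
Variables (R : comPzRingType) (nR : noetherian R).
Implicit Types (M : lmodType R) (P Q : spec R).

Let nR' : noethM R^o := noeth_ring nR.

(** A maximal annihilator is prime. Only multiples of the given x compete, so the element found
    inherits the divisibility properties of x. *)
Lemma ass_exists M (x : M) : x != 0 ->
  exists (b : R) (z : spec R), forall a : R, z a <-> a *: (b *: x) = 0.
Proof.
move=> /eqP x0.
pose P (W : ideal R) := exists b : R, b *: x <> 0 /\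
   forall a : R, W a <-> a *: (b *: x) = 0.
pose ann y : ideal R := colon (zeromod M) (line y).
have annP (y : M) (a : R) : ann y a <-> a *: y = 0.
  split=> [h|h _ [c ->]]; first by have := h y (line_id y).
  by rewrite scalerA mulrC -scalerA h scaler0; exact: submod0.
have [|W [[b [bx Wb]] hmax]] := @noeth_max R R^o P (ann x) nR'.
  by exists 1; rewrite scale1r; split=> // a; exact: annP.
suff pW : is_prime W by exists b, (Spec pW).
split=> [/Wb|c d /Wb Wcd]; first by rewrite scale1r.
apply: contrapT => /not_orP[Wc Wd]; apply: Wc; apply: (hmax (ann (d *: (b *: x)))).
- by exists (d * b); rewrite -scalerA; split=> [/Wb//|a]; exact: annP.
- by move=> a /Wb h; apply/annP; rewrite scalerA mulrC -scalerA h scaler0.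
- by apply/annP; rewrite scalerA.
Qed.

(** Some P^e M vanishes locally at [P] while M does not. At the last power that survives, an element
    x is locally nonzero and killed by [P]; a multiple t x has annihilator exactly [P]. *)
Lemma min_ann_ass M P : noethM M -> (forall a, Ann M a -> P a) ->
  (forall q : spec R, (forall a, Ann M a -> q a) -> (forall a, q a -> P a) ->
     forall a, P a -> q a) ->
  Ass M P.
Proof.
move=> nM AP minP.
have [e he] := min_prime_pow nR minP.
have nfull : ~ forall x, fullmod M x -> sat P (zeromod M) x.
  move=> /(sat_common nM)[s [Ps hs]]; apply: Ps; apply: AP => x.
  exact: (hs x).
have: forall x, adic P M e x -> sat P (zeromod M) x.
  apply: mulmod_min => a y /he[s [Ps hs]] _; exists s; split=> //.
  by rewrite scalerA; exact: hs.
elim: e {he} => [|e ih] he; first by case: nfull => x _; apply/he/mulmod_full.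
have [/ih//|/existsNP[x /not_implyP[hx nx]]] :=
  EM (forall x, adic P M e x -> sat P (zeromod M) x).
have [|t [Pt ht]] := @sat_common R M P (zeromod M) (mulmod P (line x)) nM.
  apply: mulmod_min => a _ Pa [c ->]; apply: he.
  apply/(mulmodA P); apply: mulmod_in => //; exact: submodZ.
exists (t *: x) => a; split=> [Pa|ax].
  rewrite scalerA mulrC -scalerA; apply: ht; apply: mulmod_in => //; exact: line_id.
apply: contrapT => Pa; apply: nx; exists (a * t); rewrite -scalerA.
by split; [exact: primeNM|exact: ax].
Qed.

End Associated.

Lemma prime_avoidance (R : comPzRingType) (p : ideal R) (L : seq (spec R)) :
  (forall q : spec R, q \in L -> ~ (forall a, p a -> q a)) ->
  exists y, p y /\ forall q : spec R, q \in L -> ~ q y.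
Proof.
have [n] := ubnP (size L); elim: n L => // n ih [|q L] sL hL.
  by exists 0; split=> //; exact: submod0.
(* Primes inside [q] are avoided together with [q]; each remaining one has an element outside
   [q]. *)
pose L' := [seq q' : spec R <- L | ~~ `[< forall a, q' a -> q a >]].
have L'P q' : q' \in L' -> q' \in L /\ ~ (forall a, q' a -> q a).
  by rewrite mem_filter => /andP[/asboolPn].
have [||y [py hy]] := ih L'.
- by rewrite size_filter; apply: leq_ltn_trans (count_size _ _) _; rewrite -ltnS.
- by move=> q' /L'P[q'L _]; apply: hL; rewrite in_cons q'L orbT.
have fin y' : p y' -> ~ q y' -> (forall q', q' \in L' -> ~ q' y') ->
    exists y, p y /\ forall q', q' \in q :: L -> ~ q' y.
  move=> py' qy' h; exists y'; split=> // q'; rewrite in_cons => /orP[/eqP->//|q'L].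
  have [q'q /q'q//|nq'q] := EM (forall a, q' a -> q a).
  by apply: h; rewrite mem_filter q'L andbT; apply/asboolPn.
have [qy|qy] := EM (q y); last exact: fin py qy hy.
have [z [pz qz]] : exists z, p z /\ ~ q z.
  by have /existsNP[z /not_implyP[? ?]] := hL q (mem_head _ _); exists z.
have [u [hu qu]] : exists u, (forall q', q' \in L' -> q' u) /\ ~ q u.
  elim: (L') L'P => [|q' L'' ihL] hL''; first by exists 1; split=> //; exact: prime1.
  have [|u [hu qu]] := ihL; first by move=> r rL; apply: hL''; rewrite in_cons rL orbT.
  have [_ /existsNP[v /not_implyP[q'v qv]]] := hL'' q' (mem_head _ _).
  exists (v * u); split; last exact: primeNM.
  move=> r; rewrite in_cons => /orP[/eqP->|/hu]; first exact: ideal_mulr.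
  exact: ideal_mull.
(* y avoids the primes of [L'] but lies in [q]; u z lies in all of them but not in [q]. *)
apply: (fin (y + u * z)).
- by apply: submodD => //; exact: ideal_mull.
- move=> h; apply: (primeNM qu qz).
  by rewrite -(addKr y (u * z)) addrC; exact: submodB.
- move=> q' q'L h; apply: (hy q' q'L).
  rewrite -(addrK (u * z) y); apply: submodB => //.
  by apply: ideal_mulr; exact: hu.
Qed.

Section KrullIntersection.
Variables (R : comPzRingType) (nR : noetherian R).
Variables (M : lmodType R) (nM : noethM M) (Q : spec R) (W : submod M).

Let nR' : noethM R^o := noeth_ring nR.

Fact capsat_subproof :
  is_submod [set x | forall k, sat Q (smsum W (adic Q M k)) x].
Proof.
split=> [k|x y hx hy k|a x hx k]; first exact: submod0.
  by apply: submodD; [exact: hx|exact: hy].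
by apply: submodZ; exact: hx.
Qed.
Let T : submod M := Submod capsat_subproof.

(* With T the elements to be controlled, a submodule K maximal with
   K :&: T = QT (modulo W) contains Q^k M for some k. *)
Lemma krull_intersection x :
  (forall k, sat Q (smsum W (adic Q M k)) x) -> sat Q W x.
Proof.
move=> hx; have Tx : T x by exact: hx.
move: x Tx {hx}; apply: nakayama_sat => //.
pose T' := sat Q (smsum W (mulmod Q T)).
pose P (K : submod M) := [/\ saturated Q K, forall x, T' x -> K x &
  forall x, K x -> T x -> T' x].
have [|K [[sK TK KT] hmax]] := @noeth_max R M P T' nM.
  by split=> //; exact: sat_saturated.
(* Take n with (K : a^n) stable. If t in [T] is locally k + a^n u, then a t in QT gives a^(n+1) u in
   [K], so a^n u and t are in [K]. Thus K + a^n M is still admissible, and maximality puts a^n M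
   into [K]. *)
have QK a : Q a -> exists n, forall y, K (a ^+ n *: y).
  move=> Qa; pose D n := divby K (a ^+ n).
  have [n x Dx|n hn] := @noeth_acc R M D nM.
    rewrite -[D _ _]/(K (a ^+ n.+1 *: x)) exprS -scalerA.
    by apply: submodZ; exact: Dx.
  exists n => y.
  pose aM := mulmod (@line R R^o (a ^+ n)) (fullmod M).
  have aMP z : aM z -> exists y, z = a ^+ n *: y.
    apply: (@gen_min R M _ [set z | exists y, z = a ^+ n *: y]).
      split=> [|_ _ [u ->] [v ->]|b _ [u ->]].
      - by exists 0; rewrite scaler0.
      - by exists (u + v); rewrite scalerDr.
      - by exists (b *: u); rewrite !scalerA mulrC.
    move=> _ [_ [u [[b ->] _ ->]]] /=; exists (b *: u).
    by rewrite -[b *: _]/(b * a ^+ n) scalerA mulrC.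
  pose K' := sat Q (smsum K aM).
  apply: (hmax K'); last first.
  - apply/sat_sub/smsumr; apply: mulmod_in => //; exact: (@line_id R R^o).
  - by move=> z Kz; apply/sat_sub/smsuml.
  split; first exact: sat_saturated.
    by move=> z /TK Kz; apply/sat_sub/smsuml.
  move=> t [s [Qs [k [_ [Kk /aMP[u ->] es]]]]] Tt; apply: KT => //.
  apply: (sK s) => //; rewrite es; apply: submodD => //.
  apply: (hn n.+1 u); rewrite -[D _ _]/(K (a ^+ n.+1 *: u)).
  have -> : a ^+ n.+1 *: u = a *: (s *: t) - a *: k.
    by rewrite es scalerDr exprS -scalerA addrC addKr.
  apply: submodB; last exact: submodZ.
  rewrite scalerA mulrC -scalerA; apply: submodZ; apply: TK.
  by apply/sat_sub/smsumr; exact: mulmod_in.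
have [k hk] : exists k, forall a, ideal_exp Q k a -> colon K (fullmod M) a.
  apply: powers_sub => // a /QK[n hn]; exists n => y _; exact: hn.
(* Locally [T] lies in W + Q^k M, and both summands are in [K]. *)
move=> t Tt; apply: KT => //.
have [s [Qs [w [y [Ww Vy es]]]]] := Tt k.
apply: (sK s) => //; rewrite es; apply: submodD.
  by apply/TK/sat_sub/smsuml.
by move: y Vy {es}; apply: mulmod_min => a y /hk h _; exact: h.
Qed.

End KrullIntersection.

(** * Completion *)

Section CompletionFiltration.
Variables (A : comPzRingType) (m : ideal A).
Implicit Type M : lmodType A.

Fact cst_subproof M (x : M) n : qcls (adic m M n) x = qcls (adic m M n) x.
Proof. by []. Qed.
Definition cst M (x : M) : compl m M := mk_compl (cst_subproof x).

Definition ciota (a : A) : complring m := @cst A^o a.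

(** The kernel of the projection to M / m^n M. Estimates in the completion use this filtration,
    which is separated and complete by construction. *)
Definition fil M n (u : compl m M) : Prop := u n = 0.

Lemma compl_ev0 M n : (0 : compl m M) n = 0.
Proof. exact: qcls0. Qed.

Lemma compl_evD M n (u v : compl m M) : (u + v) n = u n + v n.
Proof. exact: complDE. Qed.

Lemma compl_evN M n (u : compl m M) : (- u) n = - u n.
Proof.
have := compl_ev0 M n; rewrite -(addNr u) compl_evD => /eqP.
by rewrite addr_eq0 => /eqP.
Qed.

Lemma fil_eq M n (u v : compl m M) : fil n (u - v) <-> u n = v n.
Proof.
rewrite /fil compl_evD compl_evN; split=> [/eqP|->]; last exact: subrr.
by rewrite subr_eq0 => /eqP.
Qed.

Lemma fil0 M n : fil n (0 : compl m M).
Proof. exact: compl_ev0. Qed.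

Lemma filD M n (u v : compl m M) : fil n u -> fil n v -> fil n (u + v).
Proof. by rewrite /fil compl_evD => -> ->; rewrite addr0. Qed.

Lemma filN M n (u : compl m M) : fil n u -> fil n (- u).
Proof. by rewrite /fil compl_evN => ->; rewrite oppr0. Qed.

Lemma fil_sum M n N (u : 'I_N -> compl m M) :
  (forall i, fil n (u i)) -> fil n (\sum_(i < N) u i).
Proof. by move=> h; apply: big_ind => //; [exact: fil0|exact: filD]. Qed.

Lemma fil_sep M (u : compl m M) : (forall n, fil n u) -> u = 0.
Proof. by move=> h; apply: compl_eq => n; rewrite h compl_ev0. Qed.

Lemma fil0T M (u : compl m M) : fil 0 u.
Proof.
rewrite /fil -(qcls_repr (u 0%N)) -(qcls0 m M); apply/qcls_eqP.
exact/mulmod_full.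
Qed.

Lemma cstE M (x : M) n : cst x n = qcls (adic m M n) x.
Proof. by []. Qed.

Lemma fil_cst M (x : M) n : fil n (cst x) <-> adic m M n x.
Proof.
rewrite /fil -(qcls0 m M); split=> [/qcls_eqP|h]; first by rewrite subr0.
by apply/qcls_eqP; rewrite subr0.
Qed.

Lemma fil_repr M (u : compl m M) n : fil n (u - cst (repr (u n))).
Proof. by apply/fil_eq; rewrite cstE qcls_repr. Qed.

Lemma fil_le M (u : compl m M) k n : (k <= n)%N -> fil n u -> fil k u.
Proof.
move=> /subnK<-; elim: (n - k)%N => // d ih; rewrite addSn => hd; apply: ih.
by rewrite /fil -cfamP -(qcls0 m M); apply: qcls_adicS; rewrite qcls_repr hd qcls0.
Qed.

Lemma cst0 M : cst (0 : M) = 0.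
Proof. by apply: compl_eq => n; rewrite compl_ev0 cstE qcls0. Qed.

Lemma cstD M (x y : M) : cst (x + y) = cst x + cst y.
Proof. by apply: compl_eq => n; rewrite compl_evD !cstE qclsD. Qed.

Lemma cstB M (x y : M) : cst (x - y) = cst x - cst y.
Proof. by rewrite -[in RHS](subrK y x) [in RHS]cstD addrK. Qed.

Lemma cst_sum M N (x : 'I_N -> M) : cst (\sum_(i < N) x i) = \sum_(i < N) cst (x i).
Proof. by apply: big_morph; [exact: cstD|exact: cst0]. Qed.

Lemma cstZ M a (x : M) : cst (a *: x) = ciota a *: cst x.
Proof.
apply: compl_eq => n; rewrite cstE [RHS]compl_scaleE; apply: qcls_scale.
  by symmetry; exact: (@qcls_repr A A^o).
by rewrite qcls_repr.
Qed.

Lemma ciotaM a b : ciota (a * b) = ciota a * ciota b.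
Proof. exact: (@cstZ A^o a b). Qed.

Lemma ciotaD a b : ciota (a + b) = ciota a + ciota b.
Proof. exact: (@cstD A^o). Qed.

Lemma ciota1 : ciota 1 = 1.
Proof. exact: compl_eq. Qed.

Lemma ciota0 : ciota 0 = 0.
Proof. exact: cst0. Qed.

Lemma ciotaX a n : ciota (a ^+ n) = ciota a ^+ n.
Proof. by elim: n => [|n ih]; rewrite ?ciota1 // !exprS ciotaM ih. Qed.

Lemma filZ M i j (a : complring m) (u : compl m M) :
  @fil A^o i a -> fil j u -> fil (i + j) (a *: u).
Proof.
move=> ha hu; set n := (i + j)%N.
have ha' : adic m A^o i (repr (a n)).
  apply/fil_cst; have := filD ha (filN (fil_le (leq_addr j i) (@fil_repr A^o a n))).
  by rewrite opprB addrC subrK.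
have hu' : adic m M j (repr (u n)).
  apply/fil_cst; have := filD hu (filN (fil_le (leq_addl i j) (fil_repr u n))).
  by rewrite opprB addrC subrK.
rewrite /fil -(qcls0 m M) [LHS]compl_scaleE; apply/qcls_eqP; rewrite subr0.
apply/adicD; apply: mulmod_in => //; exact/adicP.
Qed.

Lemma filZr M j (a : complring m) (u : compl m M) : fil j u -> fil j (a *: u).
Proof. exact: (filZ (i := 0%N) (@fil0T A^o a)). Qed.

Lemma filM i j (a b : complring m) :
  @fil A^o i a -> @fil A^o j b -> @fil A^o (i + j) (a * b).
Proof. exact: (@filZ A^o). Qed.

Lemma filX i (a : complring m) : @fil A^o 1 a -> @fil A^o i (a ^+ i).
Proof.
move=> ha; elim: i => [|i ih]; first exact: fil0T.
by rewrite exprS; exact: (@filM 1 i).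
Qed.

Lemma compl_series M (u : nat -> compl m M) : (forall k, fil k (u k)) ->
  exists U, forall n, fil n (U - \sum_(k < n) u k).
Proof.
move=> hu; pose S n := \sum_(k < n) u k.
have hS n : S n.+1 n = S n n.
  have -> : S n.+1 = S n + u n by rewrite /S big_ord_recr.
  by rewrite compl_evD [u n n]hu addr0.
have hx n : qcls (adic m M n) (repr (S n.+1 n.+1)) = qcls (adic m M n) (repr (S n n)).
  by rewrite cfam_repr hS.
by exists (mk_compl hx) => n; apply/fil_eq; rewrite -[RHS]qcls_repr.
Qed.

(** The differences x (j+1) - x j are expanded in [s] with coefficients in m^(j-n); for each
    generator these coefficients sum to an element of the completed ring. This turns approximations
    of u into membership in a submodule of M^*. *)
Lemma compl_span M n (x : nat -> M) (u : compl m M) (s : seq M) :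
  (forall j, (n <= j)%N -> fil j (u - cst (x j))) ->
  (forall j, (n <= j)%N ->
     mulmod (ideal_exp m (j - n)) (genmod [set` s]) (x j.+1 - x j)) ->
  exists v : nat -> complring m, u = cst (x n) + \sum_(i < size s) v i *: cst s`_i.
Proof.
move=> hu hx.
have /choice[c hc] k : exists c : nat -> A, (forall i, ideal_exp m k (c i)) /\
    x (n + k.+1)%N - x (n + k)%N = \sum_(i < size s) c i *: s`_i.
  rewrite addnS; apply: mulmod_coef; have := hx (n + k)%N (leq_addr _ _).
  by rewrite addKn.
have /choice[v hv] i : exists v : complring m, forall N,
    @fil A^o N (v - \sum_(k < N) ciota (c k i)).
  apply: (@compl_series A^o (fun k => ciota (c k i))) => k; apply/fil_cst/adicP; exact: (hc k).1.
exists v; apply/eqP; rewrite -subr_eq0; apply/eqP; apply: fil_sep => N.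
have ex : x (n + N)%N = x n + \sum_(k < N) \sum_(i < size s) c k i *: s`_i.
  elim: N => [|N ih]; first by rewrite addn0 big_ord0 addr0.
  by rewrite big_ord_recr /= -(hc N).2 addrA -ih addrC subrK.
have -> : u - (cst (x n) + \sum_(i < size s) v i *: cst s`_i) =
    (u - cst (x (n + N)%N)) +
    \sum_(i < size s) - ((v i - \sum_(k < N) ciota (c k i)) *: cst s`_i).
  rewrite ex cstD cst_sum.
  under [X in _ = _ + X]eq_bigr do rewrite scalerBl opprB scaler_suml.
  rewrite sumrB exchange_big /= opprD addrA -!addrA; congr (_ + _).
  under [X in _ = _ + (X - _)]eq_bigr do (under eq_bigr do rewrite -cstZ; rewrite -cst_sum).
  by rewrite [in RHS]opprD -[RHS]addrA addKr.
apply: filD; first by apply: fil_le (hu _ (leq_addr _ _)); exact: leq_addl.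
apply: fil_sum => i; apply: filN; have := @filZ _ N 0 _ _ (hv i N) (fil0T (cst s`_i)).
by rewrite addn0.
Qed.

End CompletionFiltration.

Definition fg_submod (R : comPzRingType) (M : lmodType R) (W : submod M) :=
  exists s : seq M, forall x, W x <-> genmod [set` s] x.

(** * Cohen's theorem on finitely generated prime ideals *)

Section Cohen.
Variable R : comPzRingType.

Lemma fg_has1 (W : ideal R) : W 1 -> fg_submod W.
Proof.
move=> W1; exists [:: 1 : R^o] => x; split=> _.
  by rewrite -[x]mulr1; apply: (@submodZ R R^o _ x 1); exact: (@genmod_head R R^o).
by rewrite -[x]mulr1; exact: ideal_mull.
Qed.

Lemma add_line_gens (W : ideal R) (a : R) (u : seq R) :
  (forall x, x \in u -> @smsum R R^o W (@line R R^o a) x) ->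
  exists ws : seq R, (forall x, x \in ws -> W x) /\
    forall x, @genmod R R^o [set` u] x ->
      exists y r, @genmod R R^o [set` ws] y /\ x = y + r * a.
Proof.
elim: u => [_|x u ih hu].
  exists [::]; split=> // x /(@genmod_nil R R^o) ->; exists 0, 0.
  by rewrite mul0r addr0; split=> //; exact: submod0.
have [w [_ [Ww [r ->] ex]]] := hu x (mem_head _ _).
have [|ws [hws hgen]] := ih; first by move=> y yu; apply: hu; rewrite in_cons yu orbT.
exists (w :: ws); split=> [y|y /(@genmod_cons R R^o)[b [_ [/hgen[z [t [hz ->]]] ->]]]].
  by rewrite in_cons => /orP[/eqP->//|]; exact: hws.
exists (b * w + z), (b * r + t); split.
  apply: submodD; last exact: (@genmod_tail R R^o).
  by apply: (@submodZ R R^o _ b w); exact: (@genmod_head R R^o).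
rewrite ex -[_ *: (_ + _)]/(b * (w + r * a)); ring.
Qed.

(** Generators of W + Ra can be corrected modulo a to lie in [W]. If x in [W] is y + r a with y in
    their span, then r is in (W : a). *)
Lemma fg_cohen_step (W : ideal R) (a : R) :
  fg_submod (@smsum R R^o W (@line R R^o a)) ->
  fg_submod (@divby R R^o W a) -> fg_submod W.
Proof.
move=> [u hu] [c hc].
have [|ws [hws hgen]] := @add_line_gens W a u.
  by move=> x xu; apply/hu; exact: sub_gen.
exists (ws ++ [seq a * x | x <- c]) => x; split=> [Wx|]; last first.
  apply: (@genmod_sub R R^o) => y; rewrite mem_cat => /orP[/hws//|/mapP[z zc ->]].
  by have /hc := @sub_gen R R^o [set` c] z zc.
have /hu/hgen[y [r [hy ex]]] : @smsum R R^o W (@line R R^o a) x by exact: smsuml.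
have Wy : W y by move: hy; exact: (@genmod_sub R R^o).
have hr : @divby R R^o W a r.
  rewrite -[divby _ _ _]/(W (a * r)).
  have -> : a * r = x - y by rewrite ex addrAC subrr add0r mulrC.
  exact: submodB.
rewrite ex; apply: submodD.
  move: hy; apply: (@genmod_sub R R^o) => z zs; apply: sub_gen => /=.
  by rewrite mem_cat zs.
move/hc: hr; rewrite mulrC; move: r {ex}.
apply: (@gen_min R R^o _
  [set r : R | @genmod R R^o [set` ws ++ [seq a * x | x <- c]] (a * r)]).
  split=> [|r t hr ht|b r hr] /=.
  - rewrite mulr0; exact: submod0.
  - rewrite mulrDr; exact: submodD.
  - rewrite -[b *: r]/(b * r) mulrCA; exact: (@submodZ R R^o).
move=> r rc; apply: sub_gen => /=.
by rewrite mem_cat map_f ?orbT.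
Qed.

(** Relative to [K] because in the completion only primes over some of the generators of m are under
    control. Zorn's lemma gives a maximal ideal over [K] that is not finitely generated. *)
Lemma cohen (K : ideal R) :
  (forall P : spec R, (forall a, K a -> P a) -> fg_submod P) ->
  forall W : ideal R, (forall a, K a -> W a) -> fg_submod W.
Proof.
move=> hP W0 KW0; apply: contrapT => nW0.
pose bad (W : ideal R) := (forall a, K a -> W a) /\ ~ fg_submod W.
pose T := {W : ideal R | bad W}.
pose rl : rel T := fun V W => `[< forall a, sval V a -> sval W a >].
have [||C totC|[W [KW nW]] hmax] := @ZL_preorder T (exist bad W0 (conj KW0 nW0)) rl.
- by move=> V; apply/asboolP.
- by move=> V U W /asboolP VU /asboolP UW; apply/asboolP => a /VU /UW.
- have [[V0 CV0]|hC] := EM (exists V, C V); last first.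
    exists (exist bad W0 (conj KW0 nW0)) => V CV; case: hC; by exists V.
  have sU : @is_submod R R^o [set a | exists2 V, C V & sval V a].
    split=> [|a b [V CV Va] [V' CV' Vb]|a b [V CV Vb]].
    - by exists V0 => //; exact: submod0.
    - have [/asboolP h|/asboolP h] := totC V V' CV CV'.
      + by exists V' => //; apply: submodD => //; exact: h.
      + by exists V => //; apply: submodD => //; exact: h.
    - by exists V => //; exact: submodZ.
  have bU : bad (Submod sU).
    split=> [a Ka|[s hs]]; first by exists V0 => //; have [h _] := svalP V0; exact: h.
    have : forall x, x \in s -> exists2 V, C V & sval V x.
      by move=> x xs; have /hs := @sub_gen R R^o [set` s] x xs.
    (* Finitely many generators of the union already lie in one member of the totally ordered
       family. *)
    have max2 : forall t : seq R, (forall x, x \in t -> exists2 V, C V & sval V x) ->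
        exists2 V, C V & forall x, x \in t -> sval V x.
      elim=> [_|x t ih ht]; first by exists V0.
      have [V CV Vx] := ht x (mem_head _ _).
      have [|V' CV' hV'] := ih; first by move=> y yt; apply: ht; rewrite in_cons yt orbT.
      have [/asboolP h|/asboolP h] := totC V V' CV CV'.
        exists V' => // y; rewrite in_cons => /orP[/eqP->|]; [exact: h|exact: hV'].
      by exists V => // y; rewrite in_cons => /orP[/eqP->//|/hV'/h].
    move=> /max2[V CV hV]; have [_] := svalP V; apply; exists s => x; split=> [Vx|].
      by apply/hs; exists V.
    exact: (@genmod_sub R R^o).
  by exists (exist bad _ bU) => V CV; apply/asboolP => a Va; exists V.
have big (V : ideal R) : (forall a, W a -> V a) -> ~ (forall a, V a -> W a) -> fg_submod V.
  move=> WV nVW; apply: contrapT => nV; apply: nVW.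
  have bV : bad V by split=> // a /KW /WV.
  by have /asboolP := hmax (exist bad V bV) (asboolT WV).
(* By maximality W + Ra and (W : a), which contains b, are finitely generated. *)
have pW : is_prime W.
  split=> [W1|a b Wab]; first by apply: (nW); exact: fg_has1.
  apply: contrapT => /not_orP[Wa Wb]; apply: (nW); apply: (@fg_cohen_step W a).
    apply: big => [x|h]; first exact: smsuml.
    by apply: Wa; apply: h; apply: smsumr; exact: (@line_id R R^o).
  apply: big => [x|h]; first exact: ideal_mull.
  by apply: Wb; exact: h.
by apply: (nW); exact: (hP (Spec pW)).
Qed.

End Cohen.

Lemma adic_repr (A : comPzRingType) (m : ideal A) (M : lmodType A) (u : compl m M) j :
  adic m M j (repr (u j.+1) - repr (u j)).
Proof. by apply/qcls_eqP; exact: cfam_repr. Qed.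

Lemma compl_fin_gen (A : comPzRingType) (m : ideal A) (M : lmodType A) :
  fin_gen M -> fin_gen (compl m M).
Proof.
move=> [s hs]; exists [seq cst m x | x <- s]; apply/predeqP => u; split=> // _.
have hcst x : x \in s -> genmod [set` [seq cst m x | x <- s]] (cst m x).
  by move=> xs; apply: sub_gen => /=; exact: map_f.
have [j _|j _|v ->] := @compl_span A m M 0 (fun j => repr (u j)) u s.
- exact: fil_repr.
- rewrite subn0; have := @adic_repr A m M u j; apply: mulmod_mono => // x _.
  by rewrite hs.
apply: submodD.
  have /genmod_coef[c ->] : genmod [set` s] (repr (u 0%N)) by rewrite hs.
  rewrite cst_sum; apply: sum_mem => i; rewrite cstZ; apply: submodZ.
  by apply: hcst; exact: mem_nth.
by apply: sum_mem => i; apply: submodZ; apply: hcst; exact: mem_nth.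
Qed.

(** * The completion of a Noetherian local ring is local and Noetherian *)

Section LocalCompletion.
Variables (A : comPzRingType) (m : ideal A).
Hypotheses (nA : noetherian A) (m1 : ~ m 1).
Hypothesis mU : forall a : A, ~ m a -> exists b : A, a * b = 1.

Local Notation B := (complring m).
Local Notation filB := (@fil A m A^o).

Lemma fil1_ciota a : filB 1 (ciota m a) <-> m a.
Proof.
split=> [/fil_cst/adicP h|ma].
  by apply: (@mulmod_min A m A^o (fullmod A^o) m) h => x y mx _; exact: ideal_mulr.
apply/fil_cst/adicP; rewrite -[a]mulr1; exact: (@mulmod_in A m A^o (fullmod A^o) a 1).
Qed.

(** [compl_span] from level 1: the first approximation of u is in m, and the later differences are
    in m^j = m^(j-1) m. *)
Lemma fil1_gen (s : seq A) : (forall a, m a -> @genmod A A^o [set` s] a) ->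
  (forall a, a \in s -> m a) ->
  forall u : B, filB 1 u -> @genmod B B^o [set` [seq ciota m a | a <- s]] u.
Proof.
move=> ms sm u hu.
have hcst a : a \in s -> @genmod B B^o [set` [seq ciota m a | a <- s]] (ciota m a).
  by move=> xs; apply: sub_gen => /=; exact: map_f.
have m_ciota a : m a -> @genmod B B^o [set` [seq ciota m a | a <- s]] (ciota m a).
  move=> /ms; apply: (@gen_min A A^o _
     [set a : A | @genmod B B^o [set` [seq ciota m a | a <- s]] (ciota m a)]).
    split=> [|x y hx hy|b x hx] /=.
    - rewrite ciota0; exact: submod0.
    - rewrite ciotaD; exact: submodD.
    - rewrite -[b *: x]/(b * x) ciotaM; exact: (@submodZ B B^o _ (ciota m b)).
  by move=> x; exact: hcst.
have [j _|j hj|v ev] := @compl_span A m A^o 1 (fun j => repr (u j)) u s.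
- exact: (@fil_repr A m A^o).
- have := @adic_repr A m A^o u j; rewrite -{1}(subnK hj) => /adicD.
  apply: (@mulmod_mono A _ _ A^o) => // a /adicP.
  apply: (@mulmod_min A m A^o (fullmod A^o) (@genmod A A^o [set` s])) => x y /ms hx _.
  exact: ideal_mulr.
rewrite ev; apply: (@submodD B B^o).
  apply: m_ciota; apply/fil1_ciota.
  have := filD hu (filN (@fil_repr A m A^o u 1)).
  by rewrite opprB addrC subrK.
apply: (@sum_mem B B^o) => i; apply: (@submodZ B B^o _ (v i)).
by apply: hcst; exact: mem_nth.
Qed.

(** If b inverts u modulo m, then g = 1 - u b has a convergent geometric series, and b times its sum
    inverts u. *)
Lemma compl_unit (u : B) : ~ filB 1 u -> exists v : B, u * v = 1.
Proof.
move=> hu; pose a : A := repr (u 1%N).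
have hf : filB 1 (u - ciota m a) by exact: (@fil_repr A m A^o).
have [|b hb] := mU (a := a).
  by move=> /fil1_ciota /(filD hf) h; apply: hu; move: h; rewrite subrK.
pose g := 1 - u * ciota m b.
have hg : filB 1 g.
  have -> : g = - (ciota m b * (u - ciota m a)).
    by rewrite mulrBr -ciotaM [b * a]mulrC hb ciota1 opprB mulrC.
  apply: filN; exact: (@filZr A m A^o).
have [v hv] := @compl_series A m A^o (fun k => g ^+ k : B) (fun k => filX k hg).
exists (ciota m b * v); apply/eqP; rewrite -subr_eq0; apply/eqP.
apply: (@fil_sep A m A^o) => N.
have -> : u * (ciota m b * v) - 1 =
    (1 - g) * (v - \sum_(k < N) g ^+ k) - g ^+ N.
  have eS : (1 - g) * \sum_(k < N) g ^+ k = 1 - g ^+ N.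
    by rewrite -opprB mulNr -subrX1 opprB.
  have eu : 1 - g = u * ciota m b by rewrite subKr.
  by rewrite mulrBr eS eu opprB [g ^+ N - 1]addrC addrA addrK mulrA.
apply: filD; last by apply: filN; exact: filX.
exact: (@filZr A m A^o N (1 - g)).
Qed.

Fact mstar_subproof : @is_submod B B^o [set u | filB 1 u].
Proof.
split=> [|u v hu hv|a u hu]; first exact: fil0.
  exact: filD.
exact: (@filZr A m A^o).
Qed.
Definition mstar_ideal : ideal B := Submod mstar_subproof.

Fact mstar_prime : is_prime mstar_ideal.
Proof.
have h1 : ~ mstar_ideal 1 by move=> h; apply: m1; apply/fil1_ciota; rewrite ciota1.
split=> // u v uv; apply: contrapT => /not_orP[/compl_unit[u' hu] /compl_unit[v' hv]].
apply: h1; have <- : u' * v' * (u * v) = 1 by rewrite mulrC mulrACA hu hv mulr1.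
exact: ideal_mull.
Qed.
Definition mstar : spec B := Spec mstar_prime.

Lemma spec_mstar (Q : spec B) u : Q u -> mstar u.
Proof.
move=> Qu; apply: contrapT => /compl_unit[v uv]; apply: (@prime1 B Q).
by rewrite -uv; exact: ideal_mulr.
Qed.

Lemma mstar_sub (Q : spec B) : (forall a, m a -> Q (ciota m a)) ->
  forall u, mstar u -> Q u.
Proof.
move=> mQ u hu; have [s hs] := nA m.
have h : forall a, a \in s -> m a by move=> a as_; rewrite hs; exact: sub_gen.
have := @fil1_gen s _ h u hu; rewrite {1}hs => /(_ (fun a ha => ha)).
by apply: (@genmod_sub B B^o) => _ /mapP[a /h /mQ ? ->].
Qed.

(* Cohen's theorem reduces the claim to ideals containing all but one of the
   generators of m, then the coefficients are obtained as power series in the last one. *)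
Lemma compl_fg_step (t : seq A) (x : A) : m x ->
  (forall W : ideal B, (forall a, a \in x :: t -> W (ciota m a)) -> fg_submod W) ->
  forall W : ideal B, (forall a, a \in t -> W (ciota m a)) -> fg_submod W.
Proof.
move=> mx hxt W tW; pose X := ciota m x.
pose K : ideal B := @genmod B B^o [set` [seq ciota m a | a <- t]].
apply: (@cohen B K) => [P KP|]; last first.
  by apply: (@genmod_sub B B^o) => _ /mapP[a /tW ? ->].
have tP a : a \in t -> P (ciota m a).
  by move=> at_; apply: KP; apply: sub_gen => /=; exact: map_f.
have [PX|nPX] := EM (P X).
  by apply: hxt => a; rewrite in_cons => /orP[/eqP->|/tP].
have [|u hu] := hxt (@smsum B B^o P (@line B B^o X)).
  move=> a; rewrite in_cons => /orP[/eqP->|/tP ?]; last exact: smsuml.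
  by apply: smsumr; exact: (@line_id B B^o).
have [|ws [wsP hws]] := @add_line_gens B P X u.
  by move=> y yu; apply/hu; exact: sub_gen.
exists ws => f; split=> [Pf|]; last exact: (@genmod_sub B B^o).
(* Since [X] is outside the prime [P], the quotient left after subtracting a combination of [ws] is
   again in [P], and the division can be iterated. *)
have /choice[next hnext] (g : {g : B | P g}) : exists cg : (nat -> B) * {g : B | P g},
    sval g = \sum_(i < size ws) cg.1 i * ws`_i + X * sval cg.2.
  case: g => g Pg /=.
  have /hu/hws[y [r [hy eg]]] : @smsum B B^o P (@line B B^o X) g by exact: smsuml.
  have Py : P y by move: hy; exact: (@genmod_sub B B^o).
  have Pr : P r.
    have er : r * X = g - y by rewrite eg addrAC subrr add0r.
    by have /primeM[//|/nPX] : P (r * X) by rewrite er; exact: submodB.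
  have [c ec] := @genmod_coef B B^o _ _ hy.
  by exists (c, exist _ r Pr) => /=; rewrite eg ec [X * r]mulrC.
pose G k := iter k (fun g => (next g).2) (exist _ f Pf).
pose c k := (next (G k)).1.
have ef N : f = \sum_(i < size ws) (\sum_(k < N) X ^+ k * c k i) * ws`_i + X ^+ N * sval (G N).
  elim: N => [|N ih].
    rewrite expr0 mul1r big1 ?add0r // => i _; by rewrite big_ord0 mul0r.
  rewrite ih hnext -/(c N) mulrDr addrA exprSr mulrA; congr (_ + _).
  rewrite mulr_sumr -big_split; apply: eq_bigr => i _ /=.
  by rewrite big_ord_recr /= mulrDl mulrA.
have hX : filB 1 X by apply/fil1_ciota.
(* The coefficients collected in N divisions are partial sums of a power series in [X]. *)
have /choice[C hC] i : exists C : B, forall N, filB N (C - \sum_(k < N) X ^+ k * c k i).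
  apply: (@compl_series A m A^o (fun k => X ^+ k * c k i)) => k.
  by rewrite mulrC; apply: (@filZr A m A^o); exact: filX.
have -> : f = \sum_(i < size ws) C i * ws`_i.
  apply/eqP; rewrite -subr_eq0; apply/eqP; apply: (@fil_sep A m A^o) => N.
  rewrite {1}(ef N) addrAC -sumrB; apply: filD; last first.
    by rewrite mulrC; apply: (@filZr A m A^o); exact: filX.
  apply: fil_sum => i; rewrite -mulrBl mulrC; apply: (@filZr A m A^o).
  by rewrite -opprB; apply: filN; exact: hC.
exact: (@genmod_comb B B^o).
Qed.

(** An ideal that contains all generators of m contains [mstar], so it is [mstar] or contains a
    unit. [compl_fg_step] then drops the generators one at a time from this condition. *)
Lemma compl_noetherian : noetherian B.
Proof.
have [s hs] := nA m.
suff h (t : seq A) : (forall a, a \in t -> m a) ->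
    (forall W : ideal B, (forall a, a \in t -> W (ciota m a)) -> fg_submod W) ->
    forall W : ideal B, fg_submod W.
  move=> W; have [|W' sW'|r hr] := h s _ _ W.
  - by move=> a as_; rewrite hs; exact: sub_gen.
  - have mW u : mstar u -> W' u.
      move=> /(@fil1_gen s); rewrite hs => hu.
      have := hu (fun a h => h) (fun a as_ => @sub_gen A A^o _ a as_).
      by apply: (@genmod_sub B B^o) => _ /mapP[a /sW' ? ->].
    have [Wm|/existsNP[u /not_implyP[Wu nu]]] := EM (forall u, W' u -> mstar u).
      exists [seq ciota m a | a <- s] => u; split=> [/Wm hu|].
        by apply: fil1_gen hu => a; rewrite hs //; exact: sub_gen.
      by apply: (@genmod_sub B B^o) => _ /mapP[a /sW' ? ->].
    have [v uv] := compl_unit nu; apply: fg_has1; rewrite -uv; exact: ideal_mulr.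
  - exists r; apply/predeqP => x; exact: hr.
elim: t => [_ h W|x t ih ht h]; first exact: h.
apply: ih => [a at_|]; first by apply: ht; rewrite in_cons at_ orbT.
by apply: compl_fg_step h; apply: ht; rewrite mem_head.
Qed.

End LocalCompletion.

(** * Lengths of chains of primes *)

Section Lengths.
Local Open Scope ereal_scope.
Implicit Types (L : set nat) (h n : nat).

(** [supremum] takes the value -oo both on the empty set and where no least upper bound is found, so
    any other value is a genuine supremum. *)
Lemma sup_lengthP L : sup_length L = -oo \/
  supremums [set (n%:Z)%:E | n in L] (sup_length L).
Proof.
rewrite /sup_length /supremum; case: ifP => _; first by left.
by case: xgetP => [x _ hx|_]; [right|left].
Qed.

Lemma sup_length_ge h L : (h%:Z)%:E <= sup_length L -> exists n, L n /\ (h <= n)%N.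
Proof.
move=> hle; apply: contrapT => hno.
have hb : ubound [set (n%:Z)%:E | n in L] (h%:Z - 1)%:E.
  move=> _ [n Ln <-]; rewrite lee_fin lerBrDr -[1%R]/(1%:Z)%R -PoszD lez_nat addn1.
  by rewrite ltnNge; apply/negP => hn; apply: hno; exists n.
have [e|[_ /(_ _ hb) hs]] := sup_lengthP L; first by rewrite e in hle.
have := le_trans hle hs; rewrite lee_fin; lia.
Qed.

Lemma sup_length_max L n : L n -> (forall k, L k -> (k <= n)%N) ->
  sup_length L = (n%:Z)%:E.
Proof.
move=> Ln hn; rewrite /sup_length /supremum; case: ifP => [/eqP e|_].
  have : [set (n%:Z)%:E | n in L] (n%:Z)%:E by exists n.
  by rewrite e.
apply: xget_unique => [|y [uy ly]].
  split=> [_ [k Lk <-]|y uy]; last by apply: uy; exists n.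
  by rewrite lee_fin lez_nat; exact: hn.
apply/eqP; rewrite eq_le; apply/andP; split.
  by apply: ly => _ [k Lk <-]; rewrite lee_fin lez_nat; exact: hn.
by apply: uy; exists n.
Qed.

(** A nonempty bounded [L] has a maximum, so the common value is finite and is a genuine supremum of
    [L'] as well. *)
Lemma sup_length_bound L L' h : (exists n, L n) -> (forall n, L n -> (n <= h)%N) ->
  sup_length L = sup_length L' -> forall n, L' n -> (n <= h)%N.
Proof.
move=> [n0 Ln0] hL e n L'n.
have exL : exists n, `[< L n >] by exists n0; apply/asboolP.
have ubL k : `[< L k >] -> (k <= h)%N by move=> /asboolP/hL.
case: (ex_maxnP exL ubL) => k /asboolP Lk kmax.
have ek := sup_length_max Lk (fun j Lj => kmax j (asboolT Lj)).
have [|[uL' _]] := sup_lengthP L'; first by rewrite -e ek.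
have : (n%:Z)%:E <= (k%:Z)%:E by rewrite -ek e; apply: uL'; exists n.
by rewrite lee_fin lez_nat => /leq_trans; apply; exact: hL.
Qed.

(** The default +oo of [infimum] is excluded because the height is assumed to be a natural
    number. *)
Lemma height_ideal_le (R : comPzRingType) (M : lmodType R) (J : ideal R) p h :
  Supp M p -> Vset J p -> (h%:Z)%:E = height_ideal M J ->
  (h%:Z)%:E <= height_prime M p.
Proof.
move=> Sp Vp; rewrite /height_ideal /infimum; case: ifP => // _.
by case: xgetP => // x -> [lx _] ->; apply: lx; exists p.
Qed.

End Lengths.

(** * Chains of primes in quotient rings *)

Section ChainTransfer.
Variable R : comPzRingType.

Lemma prime_chain_chainto (S : set (spec R)) (K : set R) n c :
  (forall P : spec R, S P -> forall a, K a -> P a) -> prime_chain S n c ->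
  chainto K n (c n).
Proof.
move=> SK [cS clt]; suff h k : (k <= n)%N -> chainto K k (c k) by exact: h.
elim: k => [_|k ih kn]; first by move=> a Ka; apply: SK => //; exact: cS.
have [le nle] := clt k kn.
by exists (c k); split=> //; apply: ih; exact: ltnW.
Qed.

Lemma chainto_prime_chain (K : set R) n Q : chainto K n Q ->
  exists c, prime_chain setT n c /\ c n = Q.
Proof.
elim: n Q => [|n ih] Q /=; first by exists (fun=> Q).
move=> [P [PQ nQP /ih[c [[_ clt] cn]]]].
exists (fun i => if (i <= n)%N then c i else Q); rewrite ltnn; split=> //; split=> // i.
rewrite ltnS => hi; have [e|i_n] := eqVneq i n; first by rewrite e leqnn ltnn cn; split.
have i_ltn : (i < n)%N by rewrite ltn_neqAle i_n.
by rewrite hi i_ltn; exact: clt.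
Qed.

Variable z : ideal R.
Let pr (a : R) : quotring z := qrcls z a.

Lemma qrcls_eqP a b : pr a = pr b <-> z (a - b).
Proof. exact: (@qcls_eqP R R^o z). Qed.

Lemma pr_eq0 a : pr a = 0 <-> z a.
Proof.
have <- : pr 0 = 0 by apply: (addrI (pr 0)); rewrite -qrclsD !addr0.
by rewrite qrcls_eqP subr0.
Qed.

Lemma comap_spec (P : spec (quotring z)) : exists Q : spec R, forall a, Q a <-> P (pr a).
Proof.
have sQ : @is_submod R R^o [set a : R | P (pr a)].
  split=> [|a b Pa Pb|a b Pb] /=.
  - have /pr_eq0 -> : z 0 by exact: submod0.
    exact: submod0.
  - by rewrite /pr qrclsD; exact: submodD.
  - rewrite -[a *: b]/(a * b) /pr -qrmulE; exact: (@submodZ (quotring z) _ P (pr a)).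
have pQ : is_prime (Submod sQ).
  split=> [h|a b]; first exact: (@prime1 _ P).
  rewrite -[Submod sQ (a * b)]/(P (pr (a * b))) /pr -qrmulE; exact: primeM.
by exists (Spec pQ).
Qed.

Lemma map_spec (Q : spec R) : (forall a, z a -> Q a) ->
  exists P : spec (quotring z), forall a, P (pr a) <-> Q a.
Proof.
move=> zQ.
have QE a b : z (a - b) -> Q a -> Q b.
  by move=> /zQ h Qa; rewrite -(subKr a b); exact: submodB.
have reprE a : Q (repr (pr a)) <-> Q a.
  have e : pr (repr (pr a)) = pr a by exact: qrcls_repr.
  by split; apply: QE; apply/qrcls_eqP.
have sP : @is_submod (quotring z) (quotring z)^o [set u : quotring z | Q (repr u)].
  split=> [|u v|u v] /=.
  - have <- : pr 0 = 0 by apply/pr_eq0; exact: submod0.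
    apply/reprE; exact: submod0.
  - move=> Qu Qv; have -> : u + v = pr (repr u + repr v).
      by rewrite /pr qrclsD !qrcls_repr.
    by apply/reprE; exact: submodD.
  - move=> Qv; have -> : u *: v = pr (repr u * repr v) by [].
    by apply/reprE; exact: ideal_mull.
have pP : is_prime (Submod sP).
  split=> [/(reprE 1)/prime1//|u v].
  rewrite -(qrcls_repr u) -(qrcls_repr v) -[_ * _]/(qrmul _ _) qrmulE.
  by move=> /reprE/primeM[h|h]; [left|right]; apply/reprE.
by exists (Spec pP).
Qed.

Lemma chainto_comap n (P : spec (quotring z)) (Q : spec R) :
  (forall a, Q a <-> P (pr a)) -> chainto [set 0] n P -> @chainto R z n Q.
Proof.
elim: n P Q => [|n ih] P Q PQ /=.
  by move=> h a za; apply/PQ; apply: h; apply/pr_eq0.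
move=> [P' [P'P nPP' h]]; have [Q' P'Q'] := comap_spec P'.
exists Q'; split; [|move=> QQ'|exact: ih P'Q' h].
  by move=> a /P'Q' /P'P /PQ.
apply: nPP' => u; rewrite -(qrcls_repr u) => Pu.
by apply/P'Q'; apply: QQ'; apply/PQ.
Qed.

Lemma chainto_map n (P : spec (quotring z)) (Q : spec R) :
  (forall a, P (pr a) <-> Q a) -> @chainto R z n Q -> chainto [set 0] n P.
Proof.
elim: n P Q => [|n ih] P Q PQ /=; first by move=> _ _ ->; exact: submod0.
move=> [Q' [Q'Q nQQ' h]]; have [P' P'Q'] := map_spec (chainto_base h).
exists P'; split; [|move=> PP'|exact: ih P'Q' h].
  move=> u; rewrite -(qrcls_repr u) => /P'Q' /Q'Q ?; exact/PQ.
by apply: nQQ' => a Qa; apply/P'Q'; apply: PP'; apply/PQ.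
Qed.

End ChainTransfer.

Lemma krull_dim_bound (R : comPzRingType) (z z' : spec R) h :
  krull_dim (quotring z) = krull_dim (quotring z') ->
  (forall n Q, @chainto R z n Q -> (n <= h)%N) ->
  forall n Q, @chainto R z' n Q -> (n <= h)%N.
Proof.
move=> e hz n Q hQ; apply: (sup_length_bound _ _ e).
(* The one-term chain formed by the image of z makes the set of lengths nonempty. *)
- have [P hP] := @map_spec R z z (fun a za => za).
  by exists 0%N, (fun=> P); split.
- move=> k [c /(@prime_chain_chainto _ _ [set 0]) hc].
  have [Q' hQ'] := comap_spec (c k).
  apply: (hz k Q'); apply: chainto_comap hQ' _; apply: hc => P _ _ ->.
  exact: submod0.
- have [P hP] := map_spec (chainto_base hQ).
  by have [c [hc _]] := chainto_prime_chain (chainto_map hP hQ); exists c.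
Qed.

(** * Local rings *)

Section LocalRing.
Variables (A : comPzRingType) (m : ideal A).
Hypotheses (nA : noetherian A) (m1 : ~ m 1).
Hypothesis mU : forall a : A, ~ m a -> exists b : A, a * b = 1.
Variable M : lmodType A.
Hypothesis fM : fin_gen M.

Local Notation B := (complring m).
Local Notation MM := (compl m M).
Local Notation filB := (@fil A m A^o).
Local Notation mstar := (mstar m1 mU).
Let nM : noethM M := noeth_fg nA fM.
Let nB : noetherian B := compl_noetherian nA m1 mU.
Let nMM : noethM MM := noeth_fg nB (compl_fin_gen m fM).

Fact local_prime : is_prime m.
Proof.
split=> // a b mab; apply: contrapT => /not_orP[/mU[a' ha] /mU[b' hb]].
apply: m1; have <- : a' * b' * (a * b) = 1 by rewrite mulrC mulrACA ha hb mulr1.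
exact: ideal_mull.
Qed.
Let mspec : spec A := Spec local_prime.

(** Elements outside m are units; hence the results stated up to saturation apply literally over a
    local ring. *)
Lemma local_saturated (W : submod M) : saturated mspec W.
Proof.
move=> s x /mU[t st] Wsx; rewrite -[x]scale1r -st mulrC -scalerA.
exact: submodZ.
Qed.

Lemma local_sat (W : submod M) x : sat mspec W x -> W x.
Proof. by move=> [s [ms h]]; apply: local_saturated h. Qed.

Lemma exp_ciota (I : ideal A) (Q : ideal B) : (forall a, I a -> Q (ciota m a)) ->
  forall k a, ideal_exp I k a -> ideal_exp Q k (ciota m a).
Proof.
move=> IQ; elim=> // k ih a.
apply: (@gen_min A A^o _ [set a : A | ideal_exp Q k.+1 (ciota m a)]).
  split=> [|x y hx hy|b x hx] /=.
  - rewrite ciota0; exact: submod0.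
  - rewrite ciotaD; exact: (@submodD B B^o).
  - rewrite -[b *: x]/(b * x) ciotaM; exact: (@submodZ B B^o _ (ciota m b)).
move=> _ [x [y [Ix hy ->]]] /=; rewrite -[x *: y]/(x * y) ciotaM.
by apply: (@mulmod_in B Q B^o); [exact: IQ|exact: ih].
Qed.

Lemma adic_cst (I : ideal A) (Q : ideal B) k x : (forall a, I a -> Q (ciota m a)) ->
  adic I M k x -> adic Q MM k (cst m x).
Proof.
move=> IQ; apply: (@gen_min A M _ [set x | adic Q MM k (cst m x)]).
  split=> [|y z hy hz|b y hy] /=.
  - rewrite cst0; exact: submod0.
  - rewrite cstD; exact: submodD.
  - rewrite cstZ; exact: submodZ.
move=> _ [a [y [Ia _ ->]]] /=; rewrite cstZ; apply: mulmod_in => //.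
exact: exp_ciota Ia.
Qed.

(** * Saturations by the maximal ideal and their limits in the completion *)

Section Saturation.
Variables (I : ideal A) (Im : forall a, I a -> m a).

Fact ml_sat_subproof k : is_submod
  [set x : M | exists e, forall a : A, ideal_exp m e a -> adic I M k (a *: x)].
Proof.
split=> [|x y [e he] [f hf]|b x [e he]].
- by exists 0%N => a _; rewrite scaler0; exact: submod0.
- exists (maxn e f) => a ha; rewrite scalerDr; apply: submodD.
    by apply: he; apply: exp_le ha; exact: leq_maxl.
  by apply: hf; apply: exp_le ha; exact: leq_maxr.
- by exists e => a /he; rewrite scalerA mulrC -scalerA; exact: submodZ.
Qed.
(* The submodule (I^k M : m^oo). *)
Definition msat k : submod M := Submod (ml_sat_subproof k).

Lemma msatS k x : msat k.+1 x -> msat k x.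
Proof. by move=> [e he]; exists e => a /he /adicS. Qed.

Lemma msat_exp k : exists e, forall x, mulmod (ideal_exp m e) (msat k) x -> adic I M k x.
Proof.
have [s hs] := nM (msat k).
have [e he] : exists e, forall x, x \in s -> forall a : A, ideal_exp m e a -> adic I M k (a *: x).
  have : forall x, x \in s -> msat k x by move=> x xs; apply/hs; exact: sub_gen.
  elim: s {hs} => [_|x s ih hs]; first by exists 0%N.
  have [e he] := hs x (mem_head _ _).
  have [|f hf] := ih; first by move=> y ys; apply: hs; rewrite in_cons ys orbT.
  exists (maxn e f) => y; rewrite in_cons => /orP[/eqP->|ys] a ha.
    by apply: he; apply: exp_le ha; exact: leq_maxl.
  by apply: hf => //; apply: exp_le ha; exact: leq_maxr.
exists e; apply: mulmod_min => a y ha /hs.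
apply: (@genmod_sub A M s (divby (adic I M k) a)) => x xs.
exact: he.
Qed.

(** The stable image at level n: classes modulo I^n M that come from every later (I^(n+k) M :
    m^oo). *)
Definition stable n : set M := fun x => forall k, smsum (msat (n + k)) (adic I M n) x.

(** By [msat_exp] a power of m sends (I^n M : m^oo) into I^n M, so the descending chain of images
    stops. *)
Lemma stable_reached n : exists K, forall x,
  smsum (msat (n + K)) (adic I M n) x -> stable n x.
Proof.
have dec k x : smsum (msat (n + k.+1)) (adic I M n) x -> smsum (msat (n + k)) (adic I M n) x.
  move=> [u [v [hu hv ->]]]; exists u, v; split=> //.
  by apply: msatS; rewrite -addnS.
have [e he] := msat_exp n.
have [|||||K hK] := @dcc_sat A M mspec (adic I M n)
    (fun k => smsum (msat (n + k)) (adic I M n)) nM.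
- exact: local_saturated.
- by move=> k; exact: local_saturated.
- exact: dec.
- by move=> k x; exact: smsumr.
- exists e => x.
  apply: mulmod_min => a y ha [u [v [hu hv ->]]]; rewrite scalerDr.
  apply: submodD; last exact: submodZ.
  by rewrite addn0 in hu; apply: he; exact: mulmod_in.
exists K => x hx k; have [Kk|/ltnW kK] := leqP K k; first exact: hK.
move: hx; have := subnK kK; move: (K - k)%N => d <-.
by elim: d => // d ih; rewrite addSn => /dec.
Qed.

Lemma stable_lift n x : stable n x -> exists y, stable n.+1 y /\ adic I M n (y - x).
Proof.
move=> hx; have [K hK] := stable_reached n.+1.
(* n + (K+1) = (n+1) + K, so u already lies in the stable image at level n+1. *)
have [u [v [hu hv ->]]] := hx K.+1.
exists u; split; last by rewrite opprD addrA subrr add0r; exact: submodN.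
by apply: hK; apply: smsuml; rewrite addSnnS.
Qed.

(* Mittag-Leffler: lifting a stable element level by level gives a nonzero limit u
   in the completion, and z is the annihilator of a multiple of u. *)
Lemma msat_dichotomy :
  (forall n, exists k, forall x, msat k x -> adic I M n x) \/
  exists z : spec B, Ass MM z /\ forall Q : spec B, (forall u, z u -> Q u) ->
    (forall a, I a -> Q (ciota m a)) -> forall u, mstar u -> Q u.
Proof.
have [|/existsNP[n0 hn0]] := EM (forall n, exists k, forall x, msat k x -> adic I M n x).
  by left.
right.
have [x0 [hx0 nx0]] : exists x, stable n0 x /\ ~ adic I M n0 x.
  have [K hK] := stable_reached n0.
  apply: contrapT => hno; apply: hn0; exists (n0 + K)%N => x hx.
  apply: contrapT => nx; apply: hno; exists x; split=> //.
  by apply: hK; exact: smsuml.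
have /choice[nxt hnxt] (nx : nat * M) : exists y, stable nx.1 nx.2 ->
    stable nx.1.+1 y /\ adic I M nx.1 (y - nx.2).
  case: nx => n x /=; have [hx|hx] := EM (stable n x); last by exists 0.
  by have [y hy] := stable_lift hx; exists y.
pose X := fix X j := if j is j'.+1 then nxt ((n0 + j')%N, X j') else x0.
have hX j : stable (n0 + j) (X j).
  elim: j => [|j ih]; first by rewrite addn0.
  by rewrite addnS; exact: (hnxt (_, _) ih).1.
have hXd j : adic I M (n0 + j) (X j.+1 - X j) by exact: (hnxt (_, _) (hX j)).2.
(* Truncated subtraction makes the sequence constantly x0 up to level n0. *)
pose y j := X (j - n0)%N.
have yd j : (n0 <= j)%N -> adic I M j (y j.+1 - y j).
  by move=> hj; rewrite /y subSn // -{1}(subnKC hj); exact: hXd.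
have ydm j : adic m M j (y j.+1 - y j).
  have [hj|hj] := leqP n0 j.
    by have := yd j hj; apply: mulmod_mono => // a; exact: exp_mono.
  rewrite /y; have -> : (j.+1 - n0 = 0)%N by apply/eqP; rewrite subn_eq0.
  by have -> : (j - n0 = 0)%N; [apply/eqP; rewrite subn_eq0 ltnW|rewrite subrr; exact: submod0].
have yx j : adic I M n0 (y j - x0).
  rewrite /y; elim: (j - n0)%N => [|k ih]; first by rewrite subrr; exact: submod0.
  rewrite -(subrK (X k) (X k.+1)) -addrA; apply: submodD => //.
  by apply: adic_le (hXd k); exact: leq_addr.
have hq j : qcls (adic m M j) (y j.+1) = qcls (adic m M j) (y j) by exact/qcls_eqP.
pose u : MM := mk_compl hq.
have uy j : fil j (u - cst m (y j)) by apply/fil_eq.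
(* If u were 0, then y k would be in m^k M and x0 in I^n0 M + m^k M for all k, hence in I^n0 M by
   Krull. *)
have u0 : u != 0.
  apply/eqP => u0; apply: nx0; apply: local_sat.
  apply: (@krull_intersection A nA M nM mspec) => k; apply: sat_sub.
  exists (x0 - y k), (y k); rewrite subrK; split=> //.
    by rewrite -opprB; apply: submodN.
  by apply/fil_cst; have := filN (uy k); rewrite u0 sub0r opprK.
have [b [z hz]] := ass_exists nB u0.
exists z; split; first by exists (b *: u).
move=> Q zQ IQ; apply: (mstar_sub nA) => a ma; apply: contrapT => Qa.
(* y l is in (I^l M : m^oo) + I^l M, and u - y l is a combination of elements of I^l M over A^* by
   [compl_span]. So a power of a, which is outside [Q], sends u into Q^l M^*. *)
have key k : sat Q (smsum (zeromod MM) (adic Q MM k)) (b *: u).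
  have k0 := leq_maxl k n0; have n0k := leq_maxr k n0; move: (maxn k n0) k0 n0k => l kl nl.
  have [v [w [[e he] hw ey]]] : smsum (msat l) (adic I M l) (y l).
    by have := hX (l - n0)%N 0%N; rewrite addn0 subnKC.
  have [g hg] := nM (adic I M l).
  have [j hj|j hj|c eu] := @compl_span A m M l y u g.
  - exact: uy.
  - have := yd j (leq_trans nl hj); rewrite -{1}(subnK hj) => /adicD.
    by apply: mulmod_mono => [a'|x']; [exact: exp_mono|move/hg].
  exists (ciota m (a ^+ e)); split.
    by rewrite ciotaX => /primeX.
  apply: smsumr; rewrite scalerA mulrC -scalerA; apply: submodZ.
  suff : adic Q MM l (ciota m (a ^+ e) *: u) by exact: adic_le.
  rewrite eu scalerDr; apply: submodD.
    rewrite -cstZ; apply: (adic_cst IQ); rewrite ey scalerDr.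
    by apply: submodD; [apply: he; exact: exprn_mem|exact: submodZ].
  apply: submodZ; apply: sum_mem => i; apply: submodZ; apply: (adic_cst IQ).
  by apply/hg; apply: sub_gen => /=; exact: mem_nth.
(* b u vanishes locally at [Q], so its annihilator z contains an element outside [Q], against z
   inside [Q]. *)
have [s [Qs hs]] := @krull_intersection B nB MM nMM Q (zeromod MM) (b *: u) key.
by apply: Qs; apply: zQ; apply/hz.
Qed.

End Saturation.

Lemma contract_spec (Q : spec B) : exists P : spec A, forall a, P a <-> Q (ciota m a).
Proof.
have sP : @is_submod A A^o [set a : A | Q (ciota m a)].
  split=> [|a b Qa Qb|a b Qb] /=.
  - rewrite ciota0; exact: submod0.
  - rewrite ciotaD; exact: submodD.
  - rewrite -[a *: b]/(a * b) ciotaM; exact: ideal_mull.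
have pP : is_prime (Submod sP).
  split=> [|a b]; rewrite -![Submod sP _]/(Q (ciota m _)).
    by rewrite ciota1; exact: prime1.
  by rewrite ciotaM; exact: primeM.
by exists (Spec pP).
Qed.

(** Parameters common to all the z, with elements taken from A. One y in m outside every z other
    than [mstar] lowers all dimensions at once, and the induction goes on with primes over z and
    y. *)
Lemma parameters (h : nat) (zs : seq (spec B)) :
  (forall z, z \in zs -> forall n Q, @chainto B z n Q -> (n <= h)%N) ->
  exists y : seq A, [/\ (size y <= h)%N, forall a, a \in y -> m a &
    forall z, z \in zs -> forall Q : spec B, (forall u, z u -> Q u) ->
      (forall a, a \in y -> Q (ciota m a)) -> forall u, mstar u -> Q u].
Proof.
elim: h zs => [|h ih] zs hzs.
  exists [::]; split=> // z zz Q zQ _; apply: contrapT => nQ.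
  have /(hzs z zz) : @chainto B z 1 mstar by exists Q; split=> //; exact: spec_mstar.
  by [].
pose zs1 := [seq z : spec B <- zs | ~~ `[< forall u, mstar u -> z u >]].
have zs1P z : z \in zs1 <-> z \in zs /\ ~ (forall u, mstar u -> z u).
  rewrite mem_filter andbC; split=> [/andP[-> /asboolPn]|[-> ?]] //.
  exact/asboolPn.
(* Prime avoidance is applied to the contractions to A; they do not contain m because m generates
   [mstar]. *)
have [cz hcz] : exists L : seq (spec A), (forall P, P \in L -> ~ (forall a, m a -> P a)) /\
    forall z, z \in zs1 -> exists2 P, P \in L & forall a, P a <-> z (ciota m a).
  elim: (zs1) (fun z => (zs1P z).1) => [_|z L ihL hL]; first by exists [::].
  have [|L' [hL' hL'']] := ihL; first by move=> z' zL; apply: hL; rewrite in_cons zL orbT.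
  have [P hP] := contract_spec z; exists (P :: L'); split=> [P'|z'].
    rewrite in_cons => /orP[/eqP->|]; last exact: hL'.
    have [_ nz] := hL z (mem_head _ _) => mP; apply: nz.
    by apply: (mstar_sub nA) => a /mP /hP.
  rewrite in_cons => /orP[/eqP->|/hL''[P' P'L hP']].
    by exists P => //; rewrite mem_head.
  by exists P' => //; rewrite in_cons P'L orbT.
have [y [my hy]] := prime_avoidance hcz.1.
have zy z : z \in zs1 -> ~ z (ciota m y).
  by move=> /hcz.2[P PL hP] /hP; exact: hy.
have [zs2 [hzs2 hzs2']] : exists L : seq (spec B),
   (forall Q, Q \in L -> exists2 z, z \in zs1 & (forall u, z u -> Q u) /\ Q (ciota m y)) /\
   forall z, z \in zs1 -> forall Q : spec B, (forall u, z u -> Q u) -> Q (ciota m y) ->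
     exists2 Q', Q' \in L & forall u, Q' u -> Q u.
  elim: (zs1) => [|z L [L' [h1 h2]]]; first by exists [::].
  have [L2 [h3 h4]] := min_prime_list nB (@smsum B B^o z (@line B B^o (ciota m y))).
  exists (L2 ++ L'); split=> [Q|z'].
    rewrite mem_cat => /orP[/h3 hQ|/h1[z' z'L hz']].
      exists z; rewrite ?mem_head //; split=> [u zu|]; apply: hQ; first exact: smsuml.
      by apply: smsumr; exact: (@line_id B B^o).
    by exists z' => //; rewrite in_cons z'L orbT.
  rewrite in_cons => /orP[/eqP-> Q zQ Qy|/h2 hz' Q zQ Qy].
    have [|Q' Q'L hQ'] := h4 Q; last by exists Q' => //; rewrite mem_cat Q'L.
    by move=> _ [u [_ [zu [r ->] ->]]]; apply: submodD; [exact: zQ|exact: submodZ].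
  by have [Q' Q'L hQ'] := hz' Q zQ Qy; exists Q' => //; rewrite mem_cat Q'L orbT.
have [|ys [sy mys hys]] := ih zs2.
  move=> Q /hzs2[z /[dup] /zs1P[zz _] z1 [zQ Qy]] n Q' hQ'.
  rewrite -ltnS; apply: (hzs z zz n.+1 Q'); apply: chainto_down hQ' => // Qz.
  by apply: (zy z z1); exact: Qz.
exists (y :: ys); split=> // [a|z zz Q zQ yQ].
  by rewrite in_cons => /orP[/eqP->//|/mys].
have [mz|nz] := EM (forall u, mstar u -> z u); first by move=> u /mz /zQ.
have z1 : z \in zs1 by apply/zs1P.
have [Q' Q'L Q'Q] := hzs2' z z1 Q zQ (yQ y (mem_head _ _)).
apply: (hys Q' Q'L Q Q'Q) => a ays; apply: yQ; by rewrite in_cons ays orbT.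
Qed.

(** The height theorem bounds the dimension of A^* / z by the size of t, and unmixedness gives this
    bound for all associated primes, to which [parameters] applies. *)
Lemma unmixed_parameters (z : spec B) (t : seq A) : unmixed m M -> Ass MM z ->
  (forall a, a \in t -> m a) ->
  (forall Q : spec B, (forall u, z u -> Q u) ->
    (forall a, a \in t -> Q (ciota m a)) -> forall u, mstar u -> Q u) ->
  exists y : seq A, [/\ (size y <= size t)%N, forall a, a \in y -> m a &
    exists e, forall x, adic m M e x -> mulmod (@genmod A A^o [set` y]) (fullmod M) x].
Proof.
move=> uM Az tm tz.
have hz n Q : @chainto B z n Q -> (n <= size t)%N.
  move=> /(@chainto_up _ _ _ Q mstar (@spec_mstar A m m1 mU Q)) h.
  rewrite -(size_map (ciota m)); apply: (krull_height nB _ _ h).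
    by move=> _ /mapP[a /tm ma ->]; exact/fil1_ciota.
  by move=> P zP tP _; apply: tz => // a at_; apply: tP; exact: map_f.
have [zs [zs1 zs2]] := min_prime_list nB (Ann MM).
pose zs' := [seq q <- zs | `[< Ass MM q >]].
have [|y [sy my hy]] := @parameters (size t) zs'.
  move=> q; rewrite mem_filter => /andP[/asboolP Aq _].
  exact: krull_dim_bound (uM _ _ Az Aq) hz.
exists y; split=> //.
pose C : ideal B := @colon B MM (mulmod (@genmod B B^o [set` [seq ciota m a | a <- y]]) (fullmod MM)) (fullmod MM).
have AnnC a : Ann MM a -> C a by move=> h x _; rewrite h; exact: submod0.
have yC a : a \in y -> C (ciota m a).
  by move=> ay x _; apply: mulmod_in => //; apply: sub_gen => /=; exact: map_f.
(* [mstar] is the only prime over C: such a prime contains Ann M^* and hence one of its minimal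
   primes, which is associated and so is covered by the choice of y. *)
have [Q CQ _|e he] := @min_prime_pow B nB C mstar.
  have [|P [AP PQ minP]] := @exists_min_prime B nB (Ann MM) Q.
    by move=> a /AnnC /CQ.
  have [q qzs qP] := zs2 P AP.
  have Aq : Ass MM q.
    apply: min_ann_ass => //; first exact: zs1.
    move=> q' Aq' q'q a qa; apply: minP => //; last exact: qP.
    by move=> b /q'q /qP.
  apply: (hy q).
  - by rewrite mem_filter qzs andbT; apply/asboolP.
  - by move=> u /qP /PQ.
  - by move=> a /yC /CQ.
exists e.
(* To any given order, combinations of y over A^* agree with combinations over A; [Cmod] does the
   same for the modules. *)
have yapprox n b : @genmod B B^o [set` [seq ciota m a | a <- y]] b ->
    exists a, @genmod A A^o [set` y] a /\ filB n (b - ciota m a).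
  apply: (@gen_min B B^o _ [set b | exists a, @genmod A A^o [set` y] a /\ filB n (b - ciota m a)]).
    split=> [|b1 b2 [a1 [h1 f1]] [a2 [h2 f2]]|b1 b2 [a2 [h2 f2]]] /=.
    - exists 0; rewrite ciota0 subr0; split; [exact: submod0|exact: fil0].
    - exists (a1 + a2); split; first exact: submodD.
      by rewrite ciotaD opprD addrACA; exact: filD.
    - pose a1 : A := repr (b1 n); exists (a1 * a2); split.
        exact: (@submodZ A A^o _ a1 a2).
      rewrite -[b1 *: b2]/(b1 * b2) ciotaM.
      have -> : b1 * b2 - ciota m a1 * ciota m a2 =
         b1 * (b2 - ciota m a2) + ciota m a2 * (b1 - ciota m a1).
        by rewrite !mulrBr [ciota m a2 * b1]mulrC [ciota m a2 * _]mulrC addrA subrK.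
      apply: filD; apply: (@filZr A m A^o) => //; exact: (@fil_repr A m A^o).
  move=> _ /mapP[a ay ->]; exists a; rewrite subrr; split; last exact: fil0.
  exact: sub_gen.
have Cmod n u : mulmod (@genmod B B^o [set` [seq ciota m a | a <- y]]) (fullmod MM) u ->
    exists x, mulmod (@genmod A A^o [set` y]) (fullmod M) x /\ fil n (u - cst m x).
  apply: (@gen_min B MM _ [set u | exists x,
    mulmod (@genmod A A^o [set` y]) (fullmod M) x /\ fil n (u - cst m x)]).
    split=> [|u1 u2 [x1 [h1 f1]] [x2 [h2 f2]]|b u1 [x1 [h1 f1]]] /=.
    - exists 0; rewrite cst0 subr0; split; [exact: submod0|exact: fil0].
    - exists (x1 + x2); split; first exact: submodD.
      by rewrite cstD opprD addrACA; exact: filD.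
    - pose a : A := repr (b n); exists (a *: x1); split; first exact: submodZ.
      rewrite cstZ.
      have -> : b *: u1 - ciota m a *: cst m x1 =
         b *: (u1 - cst m x1) + (b - ciota m a) *: cst m x1.
        by rewrite scalerBr scalerBl addrA subrK.
      apply: filD; first exact: filZr.
      have := filZ (@fil_repr A m A^o b n) (fil0T (cst m x1)).
      by rewrite addn0.
  move=> _ [b [v [/(yapprox n)[a [ya fa]] _ ->]]]; pose v0 : M := repr (v n).
  exists (a *: v0); split; first exact: mulmod_in.
  rewrite cstZ.
  have -> : b *: v - ciota m a *: cst m v0 =
     b *: (v - cst m v0) + (b - ciota m a) *: cst m v0.
    by rewrite scalerBr scalerBl addrA subrK.
  apply: filD; first by apply: filZr; exact: fil_repr.
  have := filZ fa (fil0T (cst m v0)); by rewrite addn0.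
move=> x hx; apply: local_sat; move: x hx; apply: nakayama_sat => // x hx.
apply: sat_sub; move: x hx; apply: mulmod_min => a x ha _.
have [s [ms Cs]] : @sat B B^o mstar C (ciota m a).
  by apply: he; apply: exp_ciota ha => b mb; exact/fil1_ciota.
(* Order e+1 places the error in m (m^e M), as Nakayama's lemma requires. Replacing s by the unit s0
   of A costs (s - s0) a x, of the same order. *)
have [x' [yx' fx']] := Cmod e.+1 _ (Cs (cst m x) I).
pose s0 : A := repr (s 1%N).
have fs : filB 1 (s - ciota m s0) by exact: (@fil_repr A m A^o).
have [|r hr] := mU (a := s0).
  by move=> /fil1_ciota /(filD fs) h; apply: ms; move: h; rewrite subrK.
have fa : filB e (ciota m a) by apply/fil_cst/adicP.
have hd : adic m M e.+1 (s0 *: (a *: x) - x').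
  apply/fil_cst; rewrite cstB 2!cstZ.
  have -> : ciota m s0 *: (ciota m a *: cst m x) - cst m x' =
    ((s *: (ciota m a : B^o)) *: cst m x - cst m x') -
    ((s - ciota m s0) * ciota m a) *: cst m x.
    by rewrite -[s *: _]/(s * ciota m a) mulrBl scalerBl opprB [RHS]addrC addrA subrK scalerA.
  apply: filD => //; apply: filN.
  have := filZ (filM fs fa) (fil0T (cst m x)); by rewrite addn0.
have -> : a *: x = r *: x' + r *: (s0 *: (a *: x) - x').
  by rewrite -scalerDr addrC subrK scalerA [r * _]mulrC hr scale1r.
apply: submodD; first by apply: smsuml; exact: submodZ.
by apply: smsumr; apply: submodZ; apply/(mulmodA m).
Qed.

End LocalRing.

(** * Localization *)

Section LocalizationTheory.
Variables (R : comPzRingType) (p : spec R).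
Local Notation A := (locring p).
Local Notation d1 := (denom1 p).

Lemma denomM1 (s : denom p) : denomM s d1 = s.
Proof. by apply: denom_eq; rewrite /= mulr1. Qed.

Lemma rfrac_scale (N : lmodType R) a s (x : N) t :
  rfrac a s *: frac x t = frac (a *: x) (denomM s t) :> loc p N.
Proof. exact: loc_scaleE. Qed.

Lemma fracE (N : lmodType R) (x : N) s : frac x s = rfrac 1 s *: frac x d1 :> loc p N.
Proof. by rewrite rfrac_scale scale1r denomM1. Qed.

Lemma rfracE a s : rfrac a s = rfrac 1 s * rfrac a d1 :> A.
Proof. by rewrite rfracM mul1r denomM1. Qed.

Lemma frac1D (N : lmodType R) (x y : N) : frac (x + y) d1 = frac x d1 + frac y d1 :> loc p N.
Proof. by rewrite fracD !scale1r denomM1. Qed.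

Lemma frac1Z (N : lmodType R) a (x : N) : frac (a *: x) d1 = rfrac a d1 *: frac x d1 :> loc p N.
Proof. by rewrite rfrac_scale denomM1. Qed.

Lemma rfrac1D (a b : R) : rfrac (a + b) d1 = rfrac a d1 + rfrac b d1 :> A.
Proof. exact: (@frac1D R^o). Qed.

Lemma rfrac1M (a b : R) : rfrac (a * b) d1 = rfrac a d1 * rfrac b d1 :> A.
Proof. by rewrite rfracM denomM1. Qed.

Lemma rfrac1X (a : R) n : rfrac (a ^+ n) d1 = rfrac a d1 ^+ n :> A.
Proof. by elim: n => // n ih; rewrite !exprS -ih rfracM denomM1. Qed.

Lemma frac_eq0 (N : lmodType R) (x : N) s : frac x s = 0 :> loc p N <-> sat p (zeromod N) x.
Proof.
split.
  move=> /frac_eqP[c]; rewrite scaler0 => h; exists (den c * den d1).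
  by split=> //; exact: (@denomP R p (denomM c d1)).
by move=> [c [pc h]]; apply/frac_eqP; exists (Denom pc); rewrite scaler0 /= mulr1.
Qed.

Fact extm_subproof (N : lmodType R) (W : submod N) :
  @is_submod A (loc p N) [set v | exists x s, W x /\ v = frac x s].
Proof.
split=> [|_ _ [x [s [Wx ->]]] [y [t [Wy ->]]]|u _ [x [s [Wx ->]]]].
- by exists 0, d1; split=> //; exact: submod0.
- exists (den t *: x + den s *: y), (denomM s t); split; last exact: fracD.
  by apply: submodD; exact: submodZ.
- have [a [t ->]] := rfracP u; exists (a *: x), (denomM t s).
  by rewrite rfrac_scale; split=> //; exact: submodZ.
Qed.
Definition extm (N : lmodType R) (W : submod N) : submod (loc p N) :=
  Submod (@extm_subproof N W).

Fact ext_subproof (I : ideal R) :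
  @is_submod A A^o [set u | exists (a : R) (s : denom p), I a /\ u = rfrac a s].
Proof.
split=> [|_ _ [a [s [Ia ->]]] [b [t [Ib ->]]]|u _ [a [s [Ia ->]]]].
- by exists 0, d1; split=> //; exact: submod0.
- exists (den t * a + den s * b), (denomM s t); split; last exact: rfracD.
  by apply: submodD; exact: ideal_mull.
- have [b [t ->]] := rfracP u; exists (b * a), (denomM t s).
  by split; [exact: ideal_mull|exact: rfracM].
Qed.
Definition ext (I : ideal R) : ideal A := Submod (ext_subproof I).

Lemma extm_frac (N : lmodType R) (W : submod N) x s : W x -> extm W (frac x s).
Proof. by move=> Wx; exists x, s. Qed.

(** The contraction of an extended submodule is its saturation, which links N_p to the statements
    about [sat]. *)
Lemma extm_sat (N : lmodType R) (W : submod N) x s : extm W (frac x s) -> sat p W x.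
Proof.
move=> [y [t [Wy /frac_eqP[c e]]]]; exists (den c * den t); split.
  exact: (@denomP R p (denomM c t)).
by rewrite e; exact: submodZ.
Qed.

Lemma ext_mul (N : lmodType R) (K : ideal R) (W : submod N) v :
  mulmod (ext K) (extm W) v -> extm (mulmod K W) v.
Proof.
apply: mulmod_min => _ _ [a [s [Ka ->]]] [x [t [Wx ->]]].
by rewrite rfrac_scale; apply: extm_frac; exact: mulmod_in.
Qed.

Lemma ext_exp (I : ideal R) n u : ideal_exp (ext I) n u -> ext (ideal_exp I n) u.
Proof.
elim: n u => [|n ih] u; first by have [a [s ->]] := rfracP u; exists a, s.
apply: (@mulmod_min A (ext I) A^o (ideal_exp (ext I) n) (ext (ideal_exp I n.+1))) => a b.
move=> [a' [s [Ia ->]]] /ih[b' [t [Ib ->]]].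
rewrite -[_ *: _]/(rfrac a' s * rfrac b' t) rfracM; exists (a' * b'), (denomM s t); split=> //.
exact: (@mulmod_in R I R^o).
Qed.

Lemma exp_ext (I : ideal R) n (a : R) (s : denom p) : ideal_exp I n a -> ideal_exp (ext I) n (rfrac a s).
Proof.
move=> h; suff {s} h1 : ideal_exp (ext I) n (rfrac a d1).
  by rewrite rfracE; exact: ideal_mull.
elim: n a h => // n ih a.
apply: (@gen_min R R^o _ [set a : R | ideal_exp (ext I) n.+1 (rfrac a d1)]).
  split=> /= [|x y hx hy|b x hx]; first exact: submod0.
    by have := submodD hx hy; rewrite -[_ + _]rfrac1D.
  by have := ideal_mull (rfrac b d1) hx; rewrite -rfrac1M.
move=> _ [x [y [Ix hy ->]]] /=.
rewrite -[x *: y]/(x * y) rfrac1M.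
apply: (@mulmod_in A (ext I) A^o); last exact: ih.
by exists x, d1.
Qed.

Lemma adic_extm (N : lmodType R) (I : ideal R) n v :
  adic (ext I) (loc p N) n v -> extm (adic I N n) v.
Proof.
move=> h; apply: ext_mul; move: h; apply: mulmod_mono; first exact: ext_exp.
by move=> {}v _; have [x [s ->]] := fracP v; exact: extm_frac.
Qed.

Lemma extm_adic (N : lmodType R) (I : ideal R) n (x : N) s :
  adic I N n x -> adic (ext I) (loc p N) n (frac x s).
Proof.
move=> h; rewrite fracE; apply: submodZ; move: x h.
apply: (@gen_min R N _ [set x | adic (ext I) (loc p N) n (frac x d1)]).
  split=> [|y z hy hz|b y hy] /=; first exact: submod0.
    by rewrite frac1D; exact: submodD.
  by rewrite frac1Z; exact: submodZ.
move=> _ [a [y [Ia _ ->]]] /=; rewrite frac1Z; apply: mulmod_in => //.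
exact: exp_ext.
Qed.

Lemma locmax_rfrac (a : R) (s : denom p) : locmax p (rfrac a s) <-> p a.
Proof.
split=> [[b [t [pb /rfrac_eqP[c e]]]]|pa]; last by exists a, s.
have : p (den c * den t * a) by rewrite e; exact: ideal_mull.
by move=> /primeM[/(@denomP R p (denomM c t))|].
Qed.

Lemma locmax1 : ~ locmax p 1.
Proof. by rewrite -[1]/(rfrac 1 d1) => /locmax_rfrac/prime1. Qed.

Lemma locmax_unit (u : A) : ~ locmax p u -> exists v : A, u * v = 1.
Proof.
have [a [s ->]] := rfracP u => h.
have pa : ~ p a by move=> /(locmax_rfrac _ s).
exists (rfrac (den s) (Denom pa)); rewrite rfracM -[1]/(rfrac 1 d1).
by apply/rfrac_eqP; exists d1 => /=; ring.
Qed.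

Lemma loc_noetherian : noetherian R -> noetherian A.
Proof.
move=> nR W.
have sC : @is_submod R R^o [set a : R | W (rfrac a d1)].
  split=> /= [|x y hx hy|b x hx]; first exact: submod0.
    by have := submodD hx hy; rewrite -[_ + _]rfrac1D.
  by have := ideal_mull (rfrac b d1) hx; rewrite -rfrac1M.
have [s hs] := nR (Submod sC).
exists [seq rfrac a d1 | a <- s]; apply/predeqP => u; split; last first.
  apply: (@genmod_sub A A^o) => _ /mapP[a as_ ->].
  have : Submod sC a by rewrite hs; exact: sub_gen.
  exact.
have [a [t ->]] := rfracP u => Wa.
have : Submod sC a.
  rewrite -[Submod sC a]/(W (rfrac a d1)).
  have -> : rfrac a d1 = rfrac (den t) d1 * rfrac a t :> A.
    by rewrite rfracM; apply/rfrac_eqP; exists d1 => /=; ring.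
  exact: ideal_mull.
rewrite hs rfracE => h; apply: ideal_mull; move: a h {Wa}.
apply: (@gen_min R R^o _ [set a : R |
  @genmod A A^o [set` [seq rfrac a d1 | a <- s]] (rfrac a d1)]).
  split=> /= [|x y hx hy|b x hx]; first exact: submod0.
    by have := submodD hx hy; rewrite -[_ + _]rfrac1D.
  by have := ideal_mull (rfrac b d1) hx; rewrite -rfrac1M.
by move=> a as_; apply: sub_gen => /=; exact: map_f.
Qed.

Lemma loc_fin_gen (N : lmodType R) : fin_gen N -> fin_gen (loc p N).
Proof.
move=> [s hs]; exists [seq frac x d1 | x <- s]; apply/predeqP => u; split=> // _.
have [x [t ->]] := fracP u; rewrite fracE; apply: submodZ.
have : genmod [set` s] x by rewrite hs.
move: x; apply: (@gen_min R N _ [set x : N |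
  genmod [set` [seq frac x d1 | x <- s]] (frac x d1 : loc p N)]).
  split=> [|x y hx hy|b x hx] /=; first exact: submod0.
    by rewrite frac1D; exact: submodD.
  by rewrite frac1Z; exact: submodZ.
by move=> x xs; apply: sub_gen => /=; exact: map_f.
Qed.

Lemma Supp_Ann (N : lmodType R) : Supp N p -> forall a, Ann N a -> p a.
Proof.
move=> [u /eqP u0] a Na; apply: contrapT => pa; apply: u0.
have [x [s ->]] := fracP u; apply/frac_eq0; exists a; by split=> //.
Qed.

Lemma Ann_Supp (N : lmodType R) : noethM N -> (forall a, Ann N a -> p a) -> Supp N p.
Proof.
move=> nN Np; apply: contrapT => hS.
have [|s [ps hs]] := @sat_common R N p (zeromod N) (fullmod N) nN.
  move=> x _; apply/(frac_eq0 x d1); apply: contrapT => /eqP h; apply: hS.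
  by exists (frac x d1).
by apply: ps; apply: Np => x; exact: (hs x).
Qed.

End LocalizationTheory.

Lemma compl_ann (A : comPzRingType) (m : ideal A) (M : lmodType A) a (u : compl m M) :
  Ann M a -> ciota m a *: u = 0.
Proof.
move=> Ma; apply: fil_sep => n.
rewrite -(subrK (cst m (repr (u n))) u) scalerDr -cstZ Ma cst0 addr0.
by apply: filZr; exact: fil_repr.
Qed.

(** * Symbolic powers *)

Section SymbolicPowers.
Variables (R : comPzRingType) (N : lmodType R) (I : ideal R).

Fact symb_subproof n : is_submod (symb_pow I N n).
Proof.
split=> [|x y [s [hs sx]] [t [ht ty]]|a x [s [hs sx]]].
- exists 1; rewrite scaler0; split; last exact: submod0.
  by move=> q _; exact: prime1.
- exists (s * t); split; first by move=> q hq; apply: primeNM; [exact: hs|exact: ht].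
  rewrite scalerDr; apply: submodD; last by rewrite -scalerA; exact: submodZ.
  by rewrite mulrC -scalerA; exact: submodZ.
- by exists s; split=> //; rewrite scalerA mulrC -scalerA; exact: submodZ.
Qed.
Definition symb n : submod N := Submod (symb_subproof n).

Lemma symbS n x : symb n.+1 x -> symb n x.
Proof. by move=> [s [hs /adicS sx]]; exists s. Qed.

Lemma quotmod_fin_gen (W : submod N) : fin_gen N -> fin_gen (quotmod W).
Proof.
move=> [s hs]; exists [seq qcls W x | x <- s]; apply/predeqP => u; split=> // _.
have : genmod [set` s] (repr u) by rewrite hs.
rewrite -[in X in _ -> X](qcls_repr u); move: (repr u).
apply: (@gen_min R N _ [set x : N | genmod [set` [seq qcls W x | x <- s]] (qcls W x)]).
  split=> [|x y hx hy|b x hx] /=.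
  - have -> : qcls W 0 = 0 by apply: (addrI (qcls W 0)); rewrite -qclsD !addr0.
    exact: submod0.
  - by rewrite qclsD; exact: submodD.
  - by rewrite qclsZ; exact: submodZ.
by move=> x xs; apply: sub_gen => /=; exact: map_f.
Qed.

Lemma qcls_eq0 (W : submod N) x : qcls W x = 0 <-> W x.
Proof.
have <- : qcls W 0 = 0 by apply: (addrI (qcls W 0)); rewrite -qclsD !addr0.
by rewrite qcls_eqP subr0.
Qed.

Lemma Ann_quotmod (W : submod N) a : Ann (quotmod W) a <-> forall x, W (a *: x).
Proof.
split=> h x; first by apply/qcls_eq0; rewrite qclsZ h.
by rewrite -(qcls_repr x) -qclsZ; apply/qcls_eq0.
Qed.

(** For a outside [P], N = PN locally at [P], so N would vanish there by Nakayama's lemma, although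
    [P] contains Ann N. *)
Lemma Ann_mul_prime (P : spec R) a : noethM N -> (forall b, Ann N b -> P b) ->
  (forall x, sat P (mulmod P (fullmod N)) (a *: x)) -> P a.
Proof.
move=> nN NP ha; apply: contrapT => Pa.
have h x : fullmod N x -> sat P (zeromod N) x.
  move: x; apply: nakayama_sat => // x _.
  have [s [Ps hs]] := ha x; exists (s * a); rewrite -scalerA; split.
    exact: primeNM.
  exact: smsumr.
have [s [Ps hs]] := sat_common nN h.
by apply: Ps; apply: NP => x; exact: (hs x).
Qed.

(** By [Ann_mul_prime] the prime [P] contains Ann (N/IN), and it is minimal over this ideal because
    I lies in it. *)
Lemma min_prime_mAss (P : spec R) : noetherian R -> fin_gen N ->
  (forall a, Ann N a -> I a) -> (forall a, I a -> P a) ->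
  (forall q : spec R, (forall a, I a -> q a) -> (forall a, q a -> P a) ->
     forall a, P a -> q a) ->
  mAss (quotmod (mulmod I (fullmod N))) P.
Proof.
move=> nR fN NI IP minP; have nN := noeth_fg nR fN.
set QN := quotmod _.
have IAnn a : I a -> Ann QN a.
  by move=> Ia; apply/Ann_quotmod => x; exact: mulmod_in.
split.
  apply: min_ann_ass => //; first exact: (noeth_fg nR (quotmod_fin_gen _ fN)).
    move=> a /Ann_quotmod ha; apply: Ann_mul_prime => // [b /NI /IP //|x].
    by apply: sat_sub; apply: mulmod_mono (ha x).
  by move=> q Aq qP; apply: minP => // a /IAnn /Aq.
move=> q [u hu] qP; apply/predeqP => a; split; first exact: qP.
by apply: minP => // b /IAnn hb; apply/hu; exact: hb.
Qed.

Definition good_at (P : spec R) :=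
  forall n, exists k, forall x, symb k x -> sat P (adic I N n) x.

Lemma colon_symbS n k a : colon (adic I N n) (symb k) a -> colon (adic I N n) (symb k.+1) a.
Proof. by move=> h x /symbS; exact: h. Qed.

(** K depends on n alone: [good_colon] can use it at every prime. *)
Lemma colon_stable n : noetherian R -> exists K, forall k a,
  colon (adic I N n) (symb k) a -> colon (adic I N n) (symb K) a.
Proof.
move=> nR; apply: (@noeth_acc R R^o (fun k => colon (adic I N n) (symb k))).
  exact: noeth_ring.
exact: colon_symbS.
Qed.

Lemma good_colon (P : spec R) n K : noethM N -> good_at P ->
  (forall k a, colon (adic I N n) (symb k) a -> colon (adic I N n) (symb K) a) ->
  exists s, ~ P s /\ colon (adic I N n) (symb K) s.
Proof.
move=> nN gP hK; have [k hk] := gP n; have [s [Ps hs]] := sat_common nN hk.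
by exists s; split=> //; exact: hK hs.
Qed.

Lemma good_everywhere : noetherian R -> fin_gen N -> (forall P, good_at P) ->
  symbolic_equiv_adic I N.
Proof.
move=> nR fN gP n; have nN := noeth_fg nR fN.
have [K hK] := colon_stable n nR; exists K => x hx.
suff h1 : colon (adic I N n) (symb K) 1.
  by rewrite -[x]scale1r; exact: h1.
apply: contrapT => h1.
have [||a h e|q [Cq _]] := @prime_disjoint R nR (colon (adic I N n) (symb K)) [set 1].
- by [].
- by move=> a b -> ->; rewrite /= mulr1.
- by apply: h1; rewrite -e.
have [s [qs /Cq]] := good_colon nN (gP q) hK.
exact.
Qed.

End SymbolicPowers.

(** * Induction over the primes of R *)

Section Induction.
Variables (R : comPzRingType) (N : lmodType R) (J : ideal R) (s : seq R).
Hypotheses (nR : noetherian R) (fN : fin_gen N) (uN : locally_unmixed N).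
Hypotheses (hs : (J : set R) = @genmod R R^o [set` s]).
Hypothesis hJ : (((size s)%:Z)%:E)%E = height_ideal N J.

Let nN := noeth_fg nR fN.
Let I := Rad (ideal_sum J (Ann N)).

Lemma rad_Ann a : Ann N a -> I a.
Proof.
move=> Na; exists 1%N; rewrite expr1; exists 0, a; rewrite add0r; split=> //.
exact: submod0.
Qed.

Lemma rad_J a : J a -> I a.
Proof.
move=> Ja; exists 1%N; rewrite expr1; exists a, 0; rewrite addr0; split=> //.
exact: submod0.
Qed.

(** q has height at least h = [size s], so chains of length h+1 end at p, while p would be minimal
    over Ann N and at most h elements. *)
Lemma few_parameters (p q : spec R) (y : seq (locring p)) :
  (forall a, I a -> q a) -> (forall a, q a -> p a) -> ~ (forall a, p a -> q a) ->
  (size y <= size s)%N -> (forall a, a \in y -> locmax p a) ->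
  ~ exists e, forall v, adic (locmax p) (loc p N) e v ->
    mulmod (@genmod (locring p) (locring p)^o [set` y]) (fullmod (loc p N)) v.
Proof.
move=> Iq qp npq sy my [e he].
have Sq : Supp N q by apply: Ann_Supp => // a /rad_Ann /Iq.
have Vq : Vset J q by move=> a /rad_J /Iq.
have [n [[c [hc cn]] hn]] :=
  sup_length_ge (height_ideal_le Sq Vq hJ).
have {hc} hq : @chainto R (Ann N) n.+1 p.
  exists q; split=> //; rewrite -cn; apply: prime_chain_chainto hc => P /Supp_Ann h a; exact: h.
(* Numerators of y, so that the height theorem can be applied in R itself. *)
have [a [sa pa ya]] : exists a : seq R, [/\ size a = size y, forall b, b \in a -> p b &
    forall u, u \in y -> ext p (@genmod R R^o [set` a]) u].
  elim: (y) my => [|u y' ih] my; first by exists [::].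
  have [|a [sa pa ya]] := ih; first by move=> v vy; apply: my; rewrite in_cons vy orbT.
  have [b [t [pb eu]]] := my u (mem_head _ _).
  exists (b :: a); split=> [|b'|v].
  - by rewrite /= sa.
  - by rewrite in_cons => /orP[/eqP->|/pa].
  rewrite in_cons => /orP[/eqP->|/ya[c' [t' [hc' ->]]]].
    by exists b, t; split=> //; exact: (@genmod_head R R^o).
  by exists c', t'; split=> //; exact: (@genmod_tail R R^o).
suff : (n.+1 <= size a)%N by rewrite sa => h; have := leq_trans h (leq_trans sy hn); rewrite ltnn.
(* For b in p, b^e N lies in (a) N locally at p, hence in PN locally at P, and [Ann_mul_prime] puts
   b into P. *)
apply: (krull_height nR pa _ hq) => P NP aP Pp b pb.
apply: (@primeX R P b e); apply: (@Ann_mul_prime R N) => // x.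
have : adic (locmax p) (loc p N) e (frac (b ^+ e *: x) (denom1 p)).
  rewrite frac1Z; apply: mulmod_in => //.
  have : ideal_exp (ext p p) e (rfrac (b ^+ e : R) (denom1 p)) by apply/exp_ext/exprn_mem.
  by apply: exp_mono.
move=> /he h.
have : extm p (mulmod (@genmod R R^o [set` a]) (fullmod N)) (frac (b ^+ e *: x) (denom1 p)).
  apply: ext_mul; move: h; apply: mulmod_mono.
    by apply: (@genmod_sub (locring p) (locring p)^o y) => u /ya.
  by move=> v _; have [x' [t ->]] := fracP v; exact: extm_frac.
move=> /extm_sat [t [pt ht]]; exists t; split; first by move=> /Pp.
move: ht; apply: mulmod_mono => // c'.
by apply: (@genmod_sub R R^o a) => b' /aP.
Qed.

Lemma good_at_step (p : spec R) :
  (forall q : spec R, (forall a, q a -> p a) -> ~ (forall a, p a -> q a) ->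
    good_at N I q) -> good_at N I p.
Proof.
move=> ih.
have [Ip|/existsNP[i /not_implyP[Ii pi]]] := EM (forall a, I a -> p a); last first.
  move=> n; exists 0%N => x _; exists (i ^+ n); split; first by move=> /primeX.
  by apply: mulmod_in => //; exact: exprn_mem.
have [[q [Iq qp npq]]|minp] := EM (exists q : spec R, [/\ forall a, I a -> q a,
    forall a, q a -> p a & ~ (forall a, p a -> q a)]); last first.
  have mp : mAss (quotmod (mulmod I (fullmod N))) p.
    apply: min_prime_mAss => //; first exact: rad_Ann.
    by move=> q Iq qp; apply: contrapT => npq; apply: minp; exists q.
  move=> n; exists n => x [t [ht tx]]; exists t; split=> //; exact: ht.
have Sp : Supp N p by apply: Ann_Supp => // a /rad_Ann /Ip.
have nA := @loc_noetherian R p nR; have fM := @loc_fin_gen R p N fN.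
have Im u : ext p I u -> locmax p u.
  by move=> [a [t [/Ip pa ->]]]; exists a, t.
have [hsat|[z [Az hz]]] := msat_dichotomy nA (@locmax1 R p) (@locmax_unit R p) fM Im.
  (* By induction the ideal (I^k N : (IN)^(K)) lies in no prime strictly below p, so it contains p^e
     locally at p; this sends (IN)^(K) into [msat k]. *)
  move=> n; have [k hk] := hsat n; have [K hK] := colon_stable N I k nR.
  exists K => x hx; apply: (@extm_sat R p N _ x (denom1 p)); apply: adic_extm; apply: hk.
  have [|e he] := @min_prime_pow R nR (colon (adic I N k) (symb N I K)) p.
    move=> q' Cq' q'p; apply: contrapT => npq'.
    have [t [qt /Cq']] := good_colon nN (ih q' q'p npq') hK; exact: qt.
  exists e => a ha.
  have [b [t [pb ->]]] : ext p (ideal_exp p e) a by apply: ext_exp; exact: exp_mono ha.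
  have [r [pr hr]] := he b pb.
  rewrite rfrac_scale -(@frac_scale R p N _ _ (Denom pr)) /= scalerA.
  by apply: extm_adic; exact: hr.
pose t := [seq rfrac a (denom1 p) | a <- s].
have Js a : J a -> @genmod R R^o [set` s] a by rewrite hs.
have sJ a : a \in s -> J a by move=> as_; rewrite hs; exact: sub_gen.
have [||y [sy my hy]] := @unmixed_parameters _ _ nA (@locmax1 R p) (@locmax_unit R p) _ fM z t (uN Sp) Az.
- by move=> _ /mapP[a /sJ /rad_J /Ip pa ->]; exact/locmax_rfrac.
(* A power of a in I is b + c with b in J and c in Ann N. The image of b is in Q through t; that of
   c kills the completion and so is in the associated prime z. *)
- move=> Q zQ tQ; apply: hz => // _ [a [r [[j [b [c [Jb Nc eb]]]] ->]]].
  rewrite rfracE ciotaM; apply: ideal_mull; apply: (@primeX _ Q _ j).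
  rewrite -ciotaX -rfrac1X eb rfrac1D ciotaD; apply: submodD; last first.
    apply: zQ; have [v hv] := Az; apply/hv; apply: compl_ann => w.
    have [x [t' ->]] := fracP w; rewrite rfrac_scale Nc.
    by apply/frac_eq0; exact: submod0.
  move: b Jb {eb} => b /Js; move: b.
  apply: (@gen_min R R^o _ [set b : R | Q (ciota (locmax p) (rfrac b (denom1 p)))]).
    split=> /= [|x y hx hy|b x hx].
    + have -> : rfrac 0 (denom1 p) = 0 by [].
      by rewrite ciota0; exact: submod0.
    + by have := submodD hx hy; rewrite -ciotaD -rfrac1D.
    + by have := ideal_mull (ciota (locmax p) (rfrac b (denom1 p))) hx; rewrite -ciotaM -rfrac1M.
  by move=> b bs; apply: tQ; exact: map_f.
by case: (few_parameters Iq qp npq _ my hy); rewrite -(size_map (fun a => rfrac a (denom1 p)) s).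
Qed.

Lemma good_at_all (p : spec R) : good_at N I p.
Proof.
(* By the height theorem the number of generators of p bounds the chains that end at p, which makes
   the induction well founded. *)
have [d hd] : exists d, forall n, @chainto R [set 0] n p -> (n <= d)%N.
  have [t ht] := nR p; exists (size t) => n hn.
  apply: (krull_height nR _ _ hn) => [x xt|P _ tP _ a pa].
    have : @genmod R R^o [set` t] x := @sub_gen R R^o _ x xt.
    by rewrite -ht.
  have : @genmod R R^o [set` t] a by rewrite -ht.
  by apply: (@genmod_sub R R^o t).
elim: d p hd => [|d ih] p hd; apply: good_at_step => q qp npq.
  have /hd : @chainto R [set 0] 1 p by exists q; split=> // _ ->; exact: submod0.
  by [].
apply: ih => n hn; rewrite -ltnS; apply: (hd n.+1); by exists q.
Qed.

End Induction.

Theorem theorem3p4 (R : comPzRingType) (N : lmodType R) (J : ideal R) :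
  noetherian R ->
  (exists x : N, x != 0) ->
  fin_gen N ->
  locally_unmixed N ->
  (exists u : quotmod (mulmod J (fullmod N)), u != 0) ->
  (exists s : seq R, (J : set R) = @genmod R R^o [set` s] /\
     (((size s)%:Z)%:E)%E = height_ideal N J) ->
  symbolic_equiv_adic (Rad (ideal_sum J (Ann N))) N.
Proof.
move=> nR _ fN uN _ [s [hs hJ]].
by apply: good_everywhere => // p; exact: good_at_all hs hJ p.
Qed.
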